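(* Let $n\in\mathbb{N}$. As meromorphic functions of $s\in\mathbb{C}$, $$\zeta_{\mathbb{S}^{2n+1}}(s,\lambda_{2n+1})=\sum_{i=1}^{n}\bar u(n,i)\,\zeta(2(s-i))-n^{-2s},$$ $$\zeta_{\mathbb{S}^{2n}}(s,\lambda_{2n})=\sum_{i=1}^{n}\bar v(n,i)\big(4^s-2^{2i-1}\big)\zeta(2s-2i+1)-\left(\frac{2n-1}{2}\right)^{-2s}.$$
   Context: $\mathbb{N}=\{1,2,3,\dots\}$ and $\zeta(s)$ is the Riemann zeta function. For $N\ge1$ let $m_k^N=(2k+N-1)\frac{(k+N-2)!}{k!\,(N-1)!}$ for $k\ge1$ (the multiplicity of the eigenvalue $k(k+N-1)$ of the Laplacian on the unit sphere $\mathbb{S}^N$) and $\lambda_N=\left(\frac{N-1}{2}\right)^2$. The shifted zeta function is $\zeta_{\mathbb{S}^N}(s,\lambda_N):=\sum_{k=1}^\infty m_k^N\left(k+\frac{N-1}{2}\right)^{-2s}$ for $\mathrm{Re}(s)$ large, extended meromorphically to $\mathbb{C}$. The central factorial numbers are given for $n\ge1$ by $\sum_{k=1}^nu(n,k)x^k=\prod_{i=0}^{n-1}(x-i^2)$ and $\sum_{k=1}^nv(n,k)x^k=x\prod_{i=1}^{n-1}\big(x-(2i-1)^2\big)$; moreover $\bar u(n,k):=\frac{2}{(2n)!}u(n,k)$ and $\bar v(n,k):=\frac{4^{-(n-1)}}{(2n-1)!}v(n,k)$. *)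

(* Defs.v *)
From Stdlib Require Import Reals Lra Lia Arith List ClassicalEpsilon.
From Coquelicot Require Import Coquelicot.

Open Scope C_scope.

Definition Cexp (z : C) : C :=
  (exp (Re z) * cos (Im z), exp (Re z) * sin (Im z))%R.

(* x^s for real x > 0 (principal value); [ln] is junk for x <= 0. *)
Definition cpow (x : R) (s : C) : C := Cexp (s * ln x).

(** Meromorphic functions on the complex plane.

    A function is holomorphic near [z0] when it is the sum of a convergent power
    series there.  A meromorphic function is represented by a total function
    [C -> C]: it has to take its true value wherever it is holomorphic
    (removable singularities are not allowed), while its value at a pole is
    arbitrary. *)

Definition holomorphic_at (f : C -> C) (z0 : C) : Prop :=
  exists (a : nat -> C) (r : R), (0 < r)%R /\
    forall z : C, (Cmod (z - z0) < r)%R ->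
      @is_pseries C_AbsRing C_NormedModule a (z - z0) (f z).

Definition punctured_near (z0 : C) (P : C -> Prop) : Prop :=
  exists r : R, (0 < r)%R /\
    forall z : C, z <> z0 -> (Cmod (z - z0) < r)%R -> P z.

Definition pole_at (f : C -> C) (z0 : C) : Prop :=
  exists (m : nat) (g : C -> C),
    (1 <= m)%nat /\ holomorphic_at g z0 /\ g z0 <> 0 /\
    punctured_near z0 (fun z => f z = g z / (z - z0) ^ m).

Definition meromorphic (f : C -> C) : Prop :=
  forall z0 : C, holomorphic_at f z0 \/ pole_at f z0.

(* Equality as meromorphic functions: agreement off a closed discrete set. *)
Definition meromorphic_eq (f g : C -> C) : Prop :=
  forall z0 : C, punctured_near z0 (fun z => f z = g z).

Definition sums_to_right_of (a : R) (u : nat -> C -> C) (f : C -> C) : Prop :=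
  forall s : C, (a < Re s)%R ->
    @is_series C_AbsRing C_NormedModule (fun k => u k s) (f s).

(* The two zeta functions are selected by choice among the meromorphic functions
   given by their Dirichlet series in a right half-plane.  By the identity
   theorem such a function is unique up to its values at its poles. *)

Definition is_riemann_zeta (f : C -> C) : Prop :=
  meromorphic f /\ sums_to_right_of 1 (fun k s => cpow (INR (S k)) (- s)) f.

Definition riemann_zeta : C -> C :=
  epsilon (inhabits (fun _ : C => RtoC 0)) is_riemann_zeta.

(* Multiplicity of the k-th eigenvalue of the sphere S^N, for k, N >= 1; the
   truncated subtractions are exact in that range. *)
Definition sphere_mult (N k : nat) : R :=
  (INR (2 * k + N - 1) * (INR (fact (k + N - 2)) /
     (INR (fact k) * INR (fact (N - 1)))))%R.

Definition sphere_term (N k : nat) (s : C) : C :=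
  sphere_mult N k * cpow (INR k + (INR N - 1) / 2) (- (2 * s)).

Definition is_shifted_sphere_zeta (N : nat) (f : C -> C) : Prop :=
  meromorphic f /\
  exists a : R, sums_to_right_of a (fun k => sphere_term N (S k)) f.

(* zeta_{S^N}(s, lambda_N), the shift being lambda_N = ((N-1)/2)^2. *)
Definition shifted_sphere_zeta (N : nat) : C -> C :=
  epsilon (inhabits (fun _ : C => RtoC 0)) (is_shifted_sphere_zeta N).

Open Scope R_scope.

(* [coef_roots l k] is the coefficient of x^k in the product of the linear
   factors (x - c), c ranging over the list l. *)
Fixpoint coef_roots (l : list R) (k : nat) : R :=
  match l with
  | nil => if (k =? 0)%nat then 1 else 0
  | c :: l' =>
      match k with O => 0 | S j => coef_roots l' j end - c * coef_roots l' k
  end.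

Definition Rprod (l : list R) : R := fold_right Rmult 1 l.

Definition u_roots (n : nat) : list R := map (fun i => INR i ^ 2) (seq 0 n).

Definition v_roots (n : nat) : list R :=
  0 :: map (fun i => (2 * INR i - 1) ^ 2) (seq 1 (n - 1)).

Definition cfn_u (n k : nat) : R := coef_roots (u_roots n) k.
Definition cfn_v (n k : nat) : R := coef_roots (v_roots n) k.

Lemma coef_roots_gt (l : list R) (k : nat) :
  (length l < k)%nat -> coef_roots l k = 0.
Proof.
revert k; induction l as [|c l IH]; intros [|k] Hk; simpl in *; try lia; auto.
rewrite !IH by lia; ring.
Qed.

Local Ltac ring_R :=
  unfold plus; simpl;
  match goal with |- @eq _ ?a ?b => change (@eq R a b) end; ring.

Lemma coef_roots_prod (l : list R) (x : R) :
  sum_n (fun k => coef_roots l k * x ^ k) (length l) =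
  Rprod (map (fun c => x - c) l).
Proof.
induction l as [|c l IH]; [rewrite sum_O; ring_R|].
change (length (c :: l)) with (S (length l)).
change (Rprod (map (fun c => x - c) (c :: l)))
  with ((x - c) * Rprod (map (fun c => x - c) l)).
rewrite <- IH.
assert (E : forall n : nat,
  sum_n (fun k => coef_roots (c :: l) k * x ^ k) (S n) =
  (x - c) * sum_n (fun k => coef_roots l k * x ^ k) n
  - c * (coef_roots l (S n) * x ^ S n)).
{ induction n as [|n IHn].
  - rewrite sum_Sn, !sum_O; ring_R.
  - rewrite sum_Sn, IHn, (sum_Sn _ n); ring_R. }
rewrite E, coef_roots_gt by lia; ring_R.
Qed.

Lemma coef_roots_0 (l : list R) (n : nat) (x : R) :
  coef_roots l 0 = 0 -> length l = n -> (1 <= n)%nat ->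
  sum_n_m (fun k => coef_roots l k * x ^ k) 1 n =
  Rprod (map (fun c => x - c) l).
Proof.
intros H0 Hl Hn; rewrite <- coef_roots_prod, Hl; unfold sum_n.
rewrite (sum_Sn_m _ 0) by lia; rewrite H0, Rmult_0_l.
symmetry; apply (plus_zero_l (G := R_AbelianMonoid)).
Qed.

(* The generating identities that define the central factorial numbers. *)

Lemma cfn_u_spec (n : nat) (x : R) : (1 <= n)%nat ->
  sum_n_m (fun k => cfn_u n k * x ^ k) 1 n =
  Rprod (map (fun i => x - INR i ^ 2) (seq 0 n)).
Proof.
intros Hn; unfold cfn_u; rewrite coef_roots_0; auto.
- unfold u_roots; now rewrite map_map.
- destruct n; [lia|]; simpl; ring.
- unfold u_roots; now rewrite length_map, length_seq.
Qed.

Lemma cfn_v_spec (n : nat) (x : R) : (1 <= n)%nat ->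
  sum_n_m (fun k => cfn_v n k * x ^ k) 1 n =
  x * Rprod (map (fun i => x - (2 * INR i - 1) ^ 2) (seq 1 (n - 1))).
Proof.
intros Hn; unfold cfn_v; rewrite coef_roots_0; auto.
- unfold v_roots; simpl; rewrite map_map; ring.
- simpl; ring.
- unfold v_roots; simpl; rewrite length_map, length_seq; lia.
Qed.

Definition ubar (n k : nat) : R := 2 / INR (fact (2 * n)) * cfn_u n k.

Definition vbar (n k : nat) : R :=
  / 4 ^ (n - 1) / INR (fact (2 * n - 1)) * cfn_v n k.

(* Main.v *)
Require Import Defs.
From Stdlib Require Import Reals Lra Lia ZArith List ClassicalEpsilon Classical.
From Coquelicot Require Import Coquelicot.

(** The multiplicity of the k-th eigenvalue is an even (N odd) or odd (N even)
    polynomial in the shifted variable k + (N-1)/2, whose coefficients are the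
    central factorial numbers, and it vanishes at the smaller (half-)integers
    that the series does not reach, except at k = 0, where it is 1.  So for
    Re s large the identities are rearrangements of Dirichlet series, and the
    identity theorem extends them to the plane.

    Holomorphy is handled through power series with finite weighted l1 norm
    [sum |a_j| r^j]: these form a Banach algebra, so that products, recentering,
    inverses and normally convergent series all reduce to one Fubini lemma.

    The continuation of zeta comes from expanding each term of the telescoping
    sum [sum_(m >= 2) ((m-1)^(1-s) - m^(1-s)) = 1] in powers of 1/m, which
    gives, with Z = zeta - 1,
      [(s-1) Z(s) = 1 - sum_(j >= 2) (s-1) s ... (s+j-2) / j! Z(s-1+j)].
    The right-hand side lives on a half-plane larger by one unit than Z does. *)

Open Scope C_scope.

(** * Series of complex numbers *)

(** Both zeta functions are values of [epsilon], so nothing is known about them until a meromorphic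
    function with the required series has been built. The class [meromorphic] is not closed under
    sums or products: when poles cancel, the value left at the point need not be the right one. All
    constructions therefore run in the class [weakly_meromorphic_at], which ignores the value at the
    centre, and [meromorphic_normalization] repairs the values at the end. The term 1 is removed
    from zeta because the remaining bases m are at least 2: Z(w + j) then decays like 2^(-j), while
    the binomial coefficients are bounded by a multiple of (3/2)^j, so the expansion converges
    absolutely with ratio 3/4. In the recursion only finitely many values Z(s - 1 + j) fall outside
    Re > 1; the earlier continuation supplies those, and the rest is a holomorphic tail. *)

Notation is_cseries := (@is_series C_AbsRing C_NormedModule).

Fixpoint csum (u : nat -> C) (n : nat) : C :=
  match n with O => u O | S m => csum u m + u (S m) end.

Lemma csum_sum_n (u : nat -> C) (n : nat) :
  @sum_n C_AbelianMonoid u n = csum u n.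
Proof.
induction n as [|n IH]; [exact (sum_O u)|].
rewrite sum_Sn, IH; reflexivity.
Qed.

Lemma is_cseries_eps (u : nat -> C) (l : C) :
  is_cseries u l <->
  forall eps : R, (0 < eps)%R -> exists N : nat, forall n : nat, (N <= n)%nat ->
    (Cmod (csum u n - l) < eps)%R.
Proof.
unfold is_series; rewrite (filterlim_locally_ball_norm (K := C_AbsRing)
  (U := C_NormedModule)); unfold ball_norm; split.
- intros H eps He; destruct (H (mkposreal eps He)) as [N HN].
  exists N; intros n Hn; rewrite <- csum_sum_n; exact (HN n Hn).
- intros H eps; destruct (H eps (cond_pos eps)) as [N HN].
  exists N; intros n Hn; specialize (HN n Hn).
  rewrite <- csum_sum_n in HN; exact HN.
Qed.

Lemma csum_ext (u v : nat -> C) (n : nat) :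
  (forall k, (k <= n)%nat -> u k = v k) -> csum u n = csum v n.
Proof.
induction n as [|n IH]; simpl; intros H; [apply H; lia|].
rewrite IH, H; auto.
Qed.

Lemma csum_plus (u v : nat -> C) (n : nat) :
  csum (fun k => u k + v k) n = csum u n + csum v n.
Proof. induction n as [|n IH]; simpl; [|rewrite IH]; ring. Qed.

Lemma csum_scal (c : C) (u : nat -> C) (n : nat) :
  csum (fun k => c * u k) n = c * csum u n.
Proof. induction n as [|n IH]; simpl; [|rewrite IH]; ring. Qed.

Lemma csum_switch (a : nat -> nat -> C) (m n : nat) :
  csum (fun i => csum (a i) n) m = csum (fun j => csum (fun i => a i j) m) n.
Proof.
induction m as [|m IH]; simpl; auto.
rewrite IH, csum_plus; auto.
Qed.

Lemma sum_switch (a : nat -> nat -> R) (m n : nat) :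
  sum_f_R0 (fun i => sum_f_R0 (a i) n) m =
  sum_f_R0 (fun j => sum_f_R0 (fun i => a i j) m) n.
Proof.
induction m as [|m IH]; simpl; auto.
rewrite IH, sum_plus; auto.
Qed.

Lemma csum_shift (u : nat -> C) (n : nat) :
  csum u (S n) = u 0%nat + csum (fun k => u (S k)) n.
Proof.
induction n as [|n IH]; [reflexivity|].
change (csum u (S (S n))) with (csum u (S n) + u (S (S n))).
rewrite IH; simpl; ring.
Qed.

Lemma Cmod_csum_le (u : nat -> C) (n : nat) :
  (Cmod (csum u n) <= sum_f_R0 (fun k => Cmod (u k)) n)%R.
Proof.
induction n as [|n IH]; simpl; [apply Rle_refl|].
eapply Rle_trans; [apply Cmod_triangle|]; lra.
Qed.

Lemma csum_tail_le (u : nat -> C) (v : nat -> R) (m n : nat) :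
  (m <= n)%nat -> (forall k, (Cmod (u k) <= v k)%R) ->
  (Cmod (csum u n - csum u m) <= sum_f_R0 v n - sum_f_R0 v m)%R.
Proof.
intros Hmn H; induction Hmn as [|n Hmn IH].
- replace (csum u m - csum u m) with (RtoC 0) by ring; rewrite Cmod_0; lra.
- simpl; replace (csum u n + u (S n) - csum u m)
    with ((csum u n - csum u m) + u (S n)) by ring.
  eapply Rle_trans; [apply Cmod_triangle|]; specialize (H (S n)); lra.
Qed.

Lemma is_cseries_unique (u : nat -> C) (l l' : C) :
  is_cseries u l -> is_cseries u l' -> l = l'.
Proof.
intros H H'; apply (filterlim_locally_unique (K := C_AbsRing)
  (V := C_NormedModule) (F := eventually) _ _ _ H H').
Qed.

Lemma is_cseries_ext (u v : nat -> C) (l : C) :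
  (forall k, u k = v k) -> is_cseries u l -> is_cseries v l.
Proof. apply is_series_ext. Qed.

Lemma is_cseries_plus (u v : nat -> C) (l m : C) :
  is_cseries u l -> is_cseries v m -> is_cseries (fun k => u k + v k) (l + m).
Proof. apply (is_series_plus (K := C_AbsRing) (V := C_NormedModule)). Qed.

Lemma is_cseries_scal (c : C) (u : nat -> C) (l : C) :
  is_cseries u l -> is_cseries (fun k => c * u k) (c * l).
Proof. apply (is_series_scal (K := C_AbsRing) (V := C_NormedModule)). Qed.

Lemma is_cseries_cons (u : nat -> C) (l : C) :
  is_cseries (fun k => u (S k)) l -> is_cseries u (u 0%nat + l).
Proof.
rewrite !is_cseries_eps; intros H eps He; destruct (H eps He) as [N HN].
exists (S N); intros [|n] Hn; [lia|].
rewrite csum_shift; replace (u 0%nat + csum (fun k => u (S k)) n - (u 0%nat + l))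
  with (csum (fun k => u (S k)) n - l) by ring; apply HN; lia.
Qed.

Lemma is_cseries_behead (u : nat -> C) (l : C) :
  is_cseries u l -> is_cseries (fun k => u (S k)) (l - u 0%nat).
Proof.
rewrite !is_cseries_eps; intros H eps He; destruct (H eps He) as [N HN].
exists N; intros n Hn; replace (csum (fun k => u (S k)) n - (l - u 0%nat))
  with (csum u (S n) - l) by (rewrite csum_shift; ring).
apply HN; lia.
Qed.

Lemma is_cseries_drop (u : nat -> C) (l : C) (m : nat) :
  is_cseries u l -> is_cseries (fun k => u (S m + k)%nat) (l - csum u m).
Proof.
induction m as [|m IH]; intros H; [exact (is_cseries_behead u l H)|].
simpl; replace (l - (csum u m + u (S m))) with (l - csum u m - u (S m + 0)%nat)
  by (rewrite Nat.add_0_r; ring).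
eapply is_cseries_ext, (is_cseries_behead _ _ (IH H)).
intros k; simpl; f_equal; lia.
Qed.

Lemma is_cseries_zero_from (u : nat -> C) (m : nat) :
  (forall k, (m < k)%nat -> u k = 0) -> is_cseries u (csum u m).
Proof.
intros H; rewrite is_cseries_eps; intros eps He; exists m; intros n Hn.
replace (csum u n) with (csum u m).
- replace (csum u m - csum u m) with (RtoC 0) by ring; rewrite Cmod_0; auto.
- induction Hn as [|n Hn IH]; auto; simpl; rewrite <- IH, H by lia; ring.
Qed.

Lemma is_cseries_limit_le (u : nat -> C) (l p : C) (e : R) (N : nat) :
  (forall n, (N <= n)%nat -> (Cmod (csum u n - p) <= e)%R) ->
  is_cseries u l -> (Cmod (l - p) <= e)%R.
Proof.
intros H Hl; apply Rnot_lt_le; intros Hlt; rewrite is_cseries_eps in Hl.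
destruct (Hl (Cmod (l - p) - e)%R ltac:(lra)) as [N' HN'].
specialize (HN' (max N N') ltac:(lia)); specialize (H (max N N') ltac:(lia)).
assert (T := Cmod_triangle (csum u (max N N') - p) (l - csum u (max N N'))).
replace (csum u (max N N') - p + (l - csum u (max N N'))) with (l - p) in T by ring.
replace (l - csum u (max N N')) with (- (csum u (max N N') - l)) in T by ring.
rewrite Cmod_opp in T; lra.
Qed.

Lemma is_cseries_bounded (u : nat -> C) (M : R) :
  (forall n, (sum_f_R0 (fun k => Cmod (u k)) n <= M)%R) ->
  exists l, is_cseries u l /\ (Cmod l <= M)%R.
Proof.
intros H.
assert (E : ex_series (fun k => Cmod (u k))).
{ apply ex_finite_lim_seq_incr with M.
  - intros n; rewrite sum_Sn; unfold plus; simpl.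
    assert (P := Cmod_ge_0 (u (S n))); lra.
  - intros n; rewrite sum_n_Reals; apply H. }
destruct (ex_series_le (K := C_AbsRing) (V := C_CompleteNormedModule) u
  (fun k => Cmod (u k)) (fun k => Rle_refl _) E) as [l Hl].
exists l; split; [exact Hl|].
replace l with (l - 0) by ring.
apply (is_cseries_limit_le u l 0 M 0); [|exact Hl]; intros n _.
replace (csum u n - 0) with (csum u n) by ring.
eapply Rle_trans; [apply Cmod_csum_le|apply H].
Qed.

(* The finite rectangles converge along any exhaustion: once one of them has
   absolute sum within [eps] of the supremum, every larger rectangle has its
   sum within [eps] of it. *)
Lemma cseries_fubini (a : nat -> nat -> C) (b c : nat -> C) (l : C) (M : R) :
  (forall m n, (sum_f_R0 (fun i => sum_f_R0 (fun j => Cmod (a i j)) n) m <= M)%R) ->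
  (forall i, is_cseries (a i) (b i)) ->
  (forall j, is_cseries (fun i => a i j) (c j)) ->
  is_cseries b l -> is_cseries c l.
Proof.
intros HM Hb Hc Hl.
set (A := fun m n => sum_f_R0 (fun i => sum_f_R0 (fun j => Cmod (a i j)) n) m) in *.
set (S2 := fun m n => csum (fun i => csum (a i) n) m).
(* If no rectangle came within [eps] of the supremum of all of them, [s - eps] would still be an
   upper bound. *)
assert (Hsup : forall eps : R, (0 < eps)%R -> exists m0 n0, forall m n,
  (A m n <= A m0 n0 + eps)%R).
{ intros eps He; destruct (completeness (fun x => exists m n, x = A m n)) as [s [Hs1 Hs2]].
  - exists M; intros x [m [n ->]]; apply HM.
  - exists (A 0 0)%nat; exists 0%nat, 0%nat; auto.
  - apply NNPP; intros Hn.
    assert (s <= s - eps)%R; [|lra].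
    apply Hs2; intros x [m0 [n0 ->]]; apply Rnot_lt_le; intros Hlt.
    apply Hn; exists m0, n0; intros m n.
    assert (A m n <= s)%R by (apply Hs1; exists m, n; auto); lra. }
(* The rectangle grows in one direction at a time: by rows, then, after an exchange of the finite
   sums, by columns. *)
assert (Hrect : forall m0 n0 m n, (m0 <= m)%nat -> (n0 <= n)%nat ->
  (Cmod (S2 m n - S2 m0 n0) <= A m n - A m0 n0)%R).
{ intros m0 n0 m n Hm Hn.
  replace (S2 m n - S2 m0 n0)
    with ((S2 m n - S2 m0 n) + (S2 m0 n - S2 m0 n0)) by ring.
  eapply Rle_trans; [apply Cmod_triangle|].
  assert (H1 : (Cmod (S2 m n - S2 m0 n) <= A m n - A m0 n)%R).
  { apply csum_tail_le; auto; intros k; apply Cmod_csum_le. }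
  assert (H2 : (Cmod (S2 m0 n - S2 m0 n0) <= A m0 n - A m0 n0)%R).
  { unfold S2, A; rewrite (csum_switch a m0 n), (csum_switch a m0 n0), (sum_switch _ m0 n), (sum_switch _ m0 n0).
    apply csum_tail_le; auto; intros k; apply Cmod_csum_le. }
  lra. }
(* An estimate for all long finite pieces of [n + 1] series passes to their limits; it serves once
   for rows and once for columns. *)
assert (Hlim : forall (u v : nat -> nat -> C) (w : nat -> C) p e n N,
  (forall j, is_cseries (u j) (w j)) ->
  (forall m, (N <= m)%nat -> (Cmod (csum (fun j => csum (u j) m) n - p) <= e)%R) ->
  (Cmod (csum w n - p) <= e)%R).
{ intros u _ w p e n N Hu Hle; apply is_cseries_limit_le with
    (u := fun i => csum (fun j => u j i) n) (N := N).
  - intros m Hm; rewrite <- csum_switch; auto.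
  - clear Hle; induction n as [|n IH]; simpl; [apply Hu|].
    apply is_cseries_plus; [apply IH|apply Hu]. }
rewrite is_cseries_eps; intros eps He.
(* Limits keep only non-strict bounds; two errors of at most [eps / 3] leave a strict one at the
   end. *)
destruct (Hsup (eps / 3)%R ltac:(lra)) as [m0 [n0 H0]].
assert (Hr : forall m n, (m0 <= m)%nat -> (n0 <= n)%nat ->
  (Cmod (S2 m n - S2 m0 n0) <= eps / 3)%R).
{ intros m n Hm Hn; assert (T := Hrect _ _ _ _ Hm Hn); specialize (H0 m n); lra. }
assert (Hl' : (Cmod (l - S2 m0 n0) <= eps / 3)%R).
{ apply is_cseries_limit_le with b m0; auto; intros m Hm.
  apply (Hlim a a b _ _ m n0); auto; intros n Hn; apply Hr; auto. }
exists n0; intros n Hn.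
assert (Hc' : (Cmod (csum c n - S2 m0 n0) <= eps / 3)%R).
{ apply (Hlim (fun j i => a i j) a c _ _ n m0); auto; intros m Hm.
  rewrite csum_switch; apply Hr; auto. }
replace (csum c n - l) with ((csum c n - S2 m0 n0) + - (l - S2 m0 n0)) by ring.
eapply Rle_lt_trans; [apply Cmod_triangle|]; rewrite Cmod_opp; lra.
Qed.

(** * Power series with finite weighted l1 norm *)

(** [M] is any bound on the norm, not its value, so no supremum has to be named. The disc is closed,
    since the weighted coefficients still sum on its boundary. *)
Definition majorized (f : C -> C) (z0 : C) (r M : R) : Prop :=
  exists a : nat -> C,
    (forall n, (sum_f_R0 (fun j => Cmod (a j) * r ^ j) n <= M)%R) /\
    forall z, (Cmod (z - z0) <= r)%R ->
      is_cseries (fun j => a j * (z - z0) ^ j) (f z).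

Lemma sum_f_R0_le (u v : nat -> R) (n : nat) :
  (forall k, (u k <= v k)%R) -> (sum_f_R0 u n <= sum_f_R0 v n)%R.
Proof. intros H; apply sum_Rle; auto. Qed.

Lemma sum_scal (c : R) (u : nat -> R) (n : nat) :
  sum_f_R0 (fun k => c * u k)%R n = (c * sum_f_R0 u n)%R.
Proof. induction n as [|n IH]; simpl; [|rewrite IH]; ring. Qed.

Lemma term_le_sum (u : nat -> R) (k n : nat) :
  (forall j, 0 <= u j)%R -> (k <= n)%nat -> (u k <= sum_f_R0 u n)%R.
Proof.
intros H Hk.
assert (Hp : forall m, (0 <= sum_f_R0 u m)%R) by (intros; apply cond_pos_sum; auto).
induction Hk as [|n Hk IH]; simpl.
- destruct k as [|k]; simpl; [lra|]; specialize (Hp k); lra.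
- specialize (H (S n)); lra.
Qed.

Lemma Cmod_coef_term (a z : C) (r : R) (j : nat) :
  (Cmod z <= r)%R -> (Cmod (a * z ^ j) <= Cmod a * r ^ j)%R.
Proof.
intros H; rewrite Cmod_mult, Cmod_pow.
apply Rmult_le_compat_l; [apply Cmod_ge_0|].
apply pow_incr; split; auto; apply Cmod_ge_0.
Qed.

Lemma majorized_ext (f g : C -> C) (z0 : C) (r M : R) :
  (forall z, (Cmod (z - z0) <= r)%R -> f z = g z) ->
  majorized f z0 r M -> majorized g z0 r M.
Proof.
intros H [a [Ha Hf]]; exists a; split; auto.
intros z Hz; rewrite <- H; auto.
Qed.

Lemma majorized_le (f : C -> C) (z0 : C) (r M M' : R) :
  (M <= M')%R -> majorized f z0 r M -> majorized f z0 r M'.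
Proof.
intros H [a [Ha Hf]]; exists a; split; auto.
intros n; eapply Rle_trans; [apply Ha|auto].
Qed.

Lemma majorized_shrink (f : C -> C) (z0 : C) (r r' M : R) :
  (0 <= r' <= r)%R -> majorized f z0 r M -> majorized f z0 r' M.
Proof.
intros H [a [Ha Hf]]; exists a; split.
- intros n; eapply Rle_trans; [|apply (Ha n)].
  apply sum_f_R0_le; intros k; apply Rmult_le_compat_l; [apply Cmod_ge_0|].
  apply pow_incr; lra.
- intros z Hz; apply Hf; lra.
Qed.

Lemma majorized_at (f : C -> C) (z0 z : C) (r M : R) :
  majorized f z0 r M -> (Cmod (z - z0) <= r)%R -> (Cmod (f z) <= M)%R.
Proof.
intros [a [Ha Hf]] Hz.
destruct (is_cseries_bounded (fun j => a j * (z - z0) ^ j) M) as [l [Hl Hb]].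
- intros n; eapply Rle_trans; [|apply (Ha n)].
  apply sum_f_R0_le; intros k; apply Cmod_coef_term; auto.
- now rewrite (is_cseries_unique _ _ _ (Hf z Hz) Hl).
Qed.

Lemma majorized_nonneg (f : C -> C) (z0 : C) (r M : R) :
  majorized f z0 r M -> (0 <= M)%R.
Proof.
intros [a [Ha _]]; eapply Rle_trans; [|apply (Ha 0%nat)].
simpl; rewrite Rmult_1_r; apply Cmod_ge_0.
Qed.

(** Absolute convergence on the closed disc lets choice assemble a function from its coefficients;
    outside the disc its value is unconstrained. *)
Lemma coefs_majorized (a : nat -> C) (z0 : C) (r M : R) :
  (forall n, (sum_f_R0 (fun j => Cmod (a j) * r ^ j) n <= M)%R) ->
  exists f, majorized f z0 r M /\
    forall z, (Cmod (z - z0) <= r)%R ->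
      is_cseries (fun j => a j * (z - z0) ^ j) (f z).
Proof.
intros Ha.
destruct (choice (fun z l => (Cmod (z - z0) <= r)%R ->
  is_cseries (fun j => a j * (z - z0) ^ j) l)) as [f Hf].
- intros z; destruct (classic (Cmod (z - z0) <= r)%R) as [Hz|Hz].
  + destruct (is_cseries_bounded (fun j => a j * (z - z0) ^ j) M) as [l [Hl _]].
    * intros n; eapply Rle_trans; [|apply (Ha n)].
      apply sum_f_R0_le; intros k; apply Cmod_coef_term; auto.
    * exists l; auto.
  + exists (RtoC 0); tauto.
- exists f; split; auto; exists a; auto.
Qed.

Lemma majorized_scal (c : C) (f : C -> C) (z0 : C) (r M : R) :
  majorized f z0 r M -> majorized (fun z => c * f z) z0 r (Cmod c * M).
Proof.
intros [a [Ha Hf]]; exists (fun j => c * a j); split.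
- intros n; rewrite (sum_eq _ (fun j => Cmod c * (Cmod (a j) * r ^ j))%R).
  + rewrite sum_scal; apply Rmult_le_compat_l; [apply Cmod_ge_0|auto].
  + intros i _; rewrite Cmod_mult; ring.
- intros z Hz; eapply is_cseries_ext, is_cseries_scal, Hf; auto.
  intros k; simpl; ring.
Qed.

Lemma majorized_plus (f g : C -> C) (z0 : C) (r M N : R) :
  (0 <= r)%R -> majorized f z0 r M -> majorized g z0 r N ->
  majorized (fun z => f z + g z) z0 r (M + N).
Proof.
intros Hr [a [Ha Hf]] [b [Hb Hg]]; exists (fun j => a j + b j); split.
- intros n; apply Rle_trans
    with (sum_f_R0 (fun j => Cmod (a j) * r ^ j + Cmod (b j) * r ^ j)%R n).
  + apply sum_f_R0_le; intros k; rewrite <- Rmult_plus_distr_r.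
    apply Rmult_le_compat_r; [apply pow_le; auto|apply Cmod_triangle].
  + rewrite sum_plus; apply Rplus_le_compat; auto.
- intros z Hz; eapply is_cseries_ext, is_cseries_plus; [|apply Hf|apply Hg]; auto.
  intros k; simpl; ring.
Qed.

Lemma majorized_shift (f : C -> C) (z0 : C) (r M : R) :
  (0 <= r)%R -> majorized f z0 r M ->
  majorized (fun z => (z - z0) * f z) z0 r (r * M).
Proof.
intros Hr Hm; assert (HM := majorized_nonneg _ _ _ _ Hm).
destruct Hm as [a [Ha Hf]].
exists (fun j => match j with O => RtoC 0 | S k => a k end); split.
- intros [|n].
  + simpl; rewrite Cmod_0, Rmult_0_l; apply Rmult_le_pos; auto.
  + rewrite decomp_sum by lia; simpl pred; rewrite Cmod_0, Rmult_0_l, Rplus_0_l.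
    rewrite (sum_eq _ (fun j => r * (Cmod (a j) * r ^ j))%R).
    * rewrite sum_scal; apply Rmult_le_compat_l; auto.
    * intros i _; simpl; ring.
- intros z Hz; replace ((z - z0) * f z) with (0 * (z - z0) ^ 0 + (z - z0) * f z) by ring.
  apply (is_cseries_cons (fun j => match j with O => RtoC 0 | S k => a k end * (z - z0) ^ j)).
  eapply is_cseries_ext, is_cseries_scal, Hf; auto; intros k; simpl; ring.
Qed.

Lemma majorized_const (c z0 : C) (r : R) : majorized (fun _ => c) z0 r (Cmod c).
Proof.
exists (fun j => match j with O => c | S _ => RtoC 0 end); split.
- intros n; rewrite (sum_eq _ (fun j => match j with O => Cmod c | S _ => 0%R end)).
  + induction n as [|n IH]; simpl; lra.
  + intros [|i] _; simpl; rewrite ?Cmod_0; ring.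
- intros z _.
  set (u := fun j => match j with O => c | S _ => RtoC 0 end * (z - z0) ^ j).
  assert (E : csum u 0 = c) by (unfold u; simpl; ring).
  rewrite <- E; apply is_cseries_zero_from; intros [|k] Hk; [lia|unfold u; ring].
Qed.

Lemma is_lim_seq_sum (u : nat -> nat -> R) (l : nat -> R) (n : nat) :
  (forall j, is_lim_seq (u j) (l j)) ->
  is_lim_seq (fun m => sum_f_R0 (fun j => u j m) n) (sum_f_R0 l n).
Proof.
intros H; induction n as [|n IH]; simpl; [apply H|].
apply is_lim_seq_plus'; auto.
Qed.

Lemma is_lim_seq_Cmod_csum (u : nat -> C) (l : C) :
  is_cseries u l -> is_lim_seq (fun n => Cmod (csum u n)) (Cmod l).
Proof.
rewrite is_cseries_eps; intros H; apply is_lim_seq_spec; intros eps.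
destruct (H eps (cond_pos eps)) as [N HN]; exists N; intros n Hn.
eapply Rle_lt_trans; [|apply (HN n Hn)].
assert (T1 := Cmod_triangle (csum u n - l) l).
assert (T2 := Cmod_triangle (l - csum u n) (csum u n)).
replace (csum u n - l + l) with (csum u n) in T1 by ring.
replace (l - csum u n + csum u n) with l in T2 by ring.
replace (l - csum u n) with (- (csum u n - l)) in T2 by ring.
rewrite Cmod_opp in T2; apply Rabs_le; lra.
Qed.

(* Weierstrass: normal convergence for the weighted l1 norm of the
   coefficients. *)
Lemma majorized_series (f : nat -> C -> C) (F : C -> C) (z0 : C) (r M : R)
    (Mk : nat -> R) :
  (0 < r)%R -> (forall k, majorized (f k) z0 r (Mk k)) ->
  (forall n, (sum_f_R0 Mk n <= M)%R) ->
  (forall z, (Cmod (z - z0) <= r)%R -> is_cseries (fun k => f k z) (F z)) ->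
  majorized F z0 r M.
Proof.
intros Hr Hf HM HF.
destruct (choice _ Hf) as [a Ha]; clear Hf.
assert (Hrect : forall m n,
  (sum_f_R0 (fun k => sum_f_R0 (fun j => Cmod (a k j) * r ^ j) n) m <= M)%R).
{ intros m n; eapply Rle_trans; [|apply (HM m)].
  apply sum_f_R0_le; intros k; apply Ha. }
assert (Hterm : forall k j, (Cmod (a k j) * r ^ j <= Mk k)%R).
{ intros k j; eapply Rle_trans; [|apply (proj1 (Ha k) j)].
  apply (term_le_sum (fun j => Cmod (a k j) * r ^ j)%R); auto; intros i.
  apply Rmult_le_pos; [apply Cmod_ge_0|apply pow_le; lra]. }
(* Column [j] is summable because its entries are at most [Mk k / r ^ j]; its sum is the j-th
   coefficient of [F]. *)
destruct (choice (fun j c => is_cseries (fun k => a k j) c)) as [c Hc].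
{ intros j; destruct (is_cseries_bounded (fun k => a k j) (M / r ^ j)%R) as [l [Hl _]].
  - intros n; assert (Hrj := pow_lt r j Hr).
    apply Rmult_le_reg_r with (r ^ j)%R; auto.
    unfold Rdiv; rewrite Rmult_assoc, Rinv_l, Rmult_1_r by lra.
    rewrite Rmult_comm, <- sum_scal; eapply Rle_trans; [|apply (HM n)].
    apply sum_f_R0_le; intros k; rewrite Rmult_comm; apply Hterm.
  - exists l; auto. }
exists c; split.
- intros n.
  (* For fixed [n], only finitely many coefficients occur: bound the norm of the partial sums up to
     [m], then let [m] grow. *)
  assert (L : is_lim_seq (fun m => sum_f_R0 (fun j =>
      Cmod (csum (fun k => a k j) m) * r ^ j)%R n)
    (sum_f_R0 (fun j => Cmod (c j) * r ^ j)%R n)).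
  { apply is_lim_seq_sum; intros j.
    apply (is_lim_seq_scal_r (fun m => Cmod (csum (fun k => a k j) m)) (r ^ j)
      (Cmod (c j))).
    apply is_lim_seq_Cmod_csum, Hc. }
  refine (is_lim_seq_le _ _ _ (Finite M) _ L (is_lim_seq_const M)); intros m.
  eapply Rle_trans; [|apply (Hrect m n)]; rewrite sum_switch.
  apply sum_f_R0_le; intros j; rewrite Rmult_comm.
  rewrite (sum_eq _ (fun k => r ^ j * Cmod (a k j))%R) by (intros; ring).
  rewrite sum_scal; apply Rmult_le_compat_l; [apply pow_le; lra|].
  apply Cmod_csum_le.
- intros z Hz.
  apply cseries_fubini with (a := fun k j => a k j * (z - z0) ^ j)
    (b := fun k => f k z) (M := M).
  + intros m n; eapply Rle_trans; [|apply (Hrect m n)].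
    apply sum_f_R0_le; intros k; apply sum_f_R0_le; intros j.
    apply Cmod_coef_term; auto.
  + intros k; apply Ha; auto.
  + intros j; rewrite Cmult_comm; eapply is_cseries_ext, is_cseries_scal, Hc.
    intros k; simpl; ring.
  + auto.
Qed.

Lemma majorized_shift_pow (f : C -> C) (z0 : C) (r M : R) (j : nat) :
  (0 <= r)%R -> majorized f z0 r M ->
  majorized (fun z => (z - z0) ^ j * f z) z0 r (r ^ j * M).
Proof.
intros Hr Hf; induction j as [|j IH]; simpl.
- rewrite Rmult_1_l; eapply majorized_ext; [|apply Hf]; intros; simpl; ring.
- rewrite Rmult_assoc; eapply majorized_ext; [|apply majorized_shift, IH; auto].
  intros; simpl; ring.
Qed.

(** The product is a normally convergent series of the functions [a j (z - z0)^j g], so no Cauchy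
    product is formed. *)
Lemma majorized_mult (f g : C -> C) (z0 : C) (r M N : R) :
  (0 < r)%R -> majorized f z0 r M -> majorized g z0 r N ->
  majorized (fun z => f z * g z) z0 r (M * N).
Proof.
intros Hr [a [Ha Hf]] Hg.
apply majorized_series with
  (f := fun j z => a j * ((z - z0) ^ j * g z))
  (Mk := fun j => (Cmod (a j) * (r ^ j * N))%R); auto.
- intros j; apply majorized_scal, majorized_shift_pow; auto; lra.
- intros n; rewrite (sum_eq _ (fun j => N * (Cmod (a j) * r ^ j))%R) by (intros; ring).
  rewrite sum_scal, Rmult_comm; apply Rmult_le_compat_r; auto.
  apply (majorized_nonneg _ _ _ _ Hg).
- intros z Hz; rewrite Cmult_comm; eapply is_cseries_ext, is_cseries_scal, Hf; auto.
  intros k; simpl; ring.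
Qed.

Lemma majorized_pow (f : C -> C) (z0 : C) (r M : R) (j : nat) :
  (0 < r)%R -> majorized f z0 r M -> majorized (fun z => f z ^ j) z0 r (M ^ j).
Proof.
intros Hr Hf; induction j as [|j IH]; simpl.
- generalize (majorized_const 1 z0 r); rewrite Cmod_1; auto.
- apply majorized_mult; auto.
Qed.

Lemma majorized_sub (p z0 : C) (r : R) :
  (0 <= r)%R -> majorized (fun z => z - p) z0 r (Cmod (z0 - p) + r).
Proof.
intros Hr; eapply majorized_ext; [|apply majorized_plus;
  [auto|apply (majorized_const (z0 - p))|]].
2: { eapply majorized_le; [|apply (majorized_shift (fun _ => 1)), majorized_const; auto].
     rewrite Cmod_1; lra. }
intros; simpl; ring.
Qed.

(** Seen from [z1], the monomial [(z - z0) ^ j] has norm at most [(|z1 - z0| + r') ^ j <= r ^ j];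
    normal convergence then rearranges the coefficients. *)
Lemma majorized_recenter (f : C -> C) (z0 z1 : C) (r r' M : R) :
  (0 < r')%R -> (Cmod (z1 - z0) + r' <= r)%R -> majorized f z0 r M ->
  majorized f z1 r' M.
Proof.
intros Hr' Hr [a [Ha Hf]].
apply majorized_series with
  (f := fun j z => a j * (z - z0) ^ j) (Mk := fun j => (Cmod (a j) * r ^ j)%R); auto.
- intros j; apply majorized_scal, majorized_pow; auto.
  eapply majorized_le, majorized_sub; lra.
- intros z Hz; apply Hf.
  replace (z - z0) with ((z - z1) + (z1 - z0)) by ring.
  eapply Rle_trans; [apply Cmod_triangle|]; lra.
Qed.

Lemma majorized_affine (f : C -> C) (al be z0 : C) (r M : R) :
  al <> 0 -> majorized f (al * z0 + be) r M ->
  majorized (fun z => f (al * z + be)) z0 (r / Cmod al) M.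
Proof.
intros Hal [a [Ha Hf]]; assert (Hm := proj1 (Cmod_gt_0 al) Hal).
exists (fun j => a j * al ^ j); split.
- intros n; eapply Rle_trans; [|apply (Ha n)]; right; apply sum_eq; intros j _.
  rewrite Cmod_mult, Cmod_pow; unfold Rdiv; rewrite Rpow_mult_distr, pow_inv.
  field; apply pow_nonzero; lra.
- intros z Hz; eapply is_cseries_ext, (Hf (al * z + be)).
  + intros j; simpl.
    replace (al * z + be - (al * z0 + be)) with (al * (z - z0)) by ring.
    rewrite Cpow_mult_l; ring.
  + replace (al * z + be - (al * z0 + be)) with (al * (z - z0)) by ring.
    rewrite Cmod_mult; apply Rmult_le_compat_l with (r := Cmod al) in Hz; [|lra].
    replace r with (Cmod al * (r / Cmod al))%R by (field; lra); auto.
Qed.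

Lemma sum_f_R0_shift_le (u : nat -> R) (m n : nat) :
  (forall k, 0 <= u k)%R ->
  (sum_f_R0 (fun k => u (m + k)%nat) n <= sum_f_R0 u (m + n))%R.
Proof.
intros H; revert u H; induction m as [|m IH]; intros u H; [apply Rle_refl|].
change (S m + n)%nat with (S (m + n)); rewrite (decomp_sum u) by lia; simpl pred.
specialize (IH (fun k => u (S k)) (fun k => H (S k))); specialize (H 0%nat).
simpl in *; lra.
Qed.

(** The tail coefficients define the quotient [g] of [f] minus its Taylor polynomial, at the cost of
    a factor [/ r ^ S m] in the norm. Continuity, inverses and the order of a zero all come from
    this. *)
Lemma majorized_factor (f : C -> C) (z0 : C) (r M : R) (a : nat -> C) (m : nat) :
  (0 < r)%R ->
  (forall n, (sum_f_R0 (fun j => Cmod (a j) * r ^ j) n <= M)%R) ->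
  (forall z, (Cmod (z - z0) <= r)%R ->
     is_cseries (fun j => a j * (z - z0) ^ j) (f z)) ->
  exists g, majorized g z0 r (M / r ^ S m) /\ g z0 = a (S m) /\
    forall z, (Cmod (z - z0) <= r)%R ->
      f z = csum (fun j => a j * (z - z0) ^ j) m + (z - z0) ^ S m * g z.
Proof.
intros Hr Ha Hf.
destruct (coefs_majorized (fun j => a (S m + j)%nat) z0 r (M / r ^ S m)) as [g [Hg Hs]].
- intros n; assert (Hp := pow_lt r (S m) Hr).
  apply Rmult_le_reg_l with (r ^ S m)%R; auto.
  replace (r ^ S m * (M / r ^ S m))%R with M by (field; lra).
  rewrite <- sum_scal; eapply Rle_trans; [|apply (Ha (S m + n)%nat)].
  eapply Rle_trans; [|apply (sum_f_R0_shift_le (fun j => Cmod (a j) * r ^ j)%R)].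
  + right; apply sum_eq; intros i _; rewrite pow_add; ring.
  + intros k; apply Rmult_le_pos; [apply Cmod_ge_0|apply pow_le; lra].
- exists g; split; [auto|split].
  + assert (H0 : Cmod (z0 - z0) = 0%R)
      by (replace (z0 - z0) with (RtoC 0) by ring; apply Cmod_0).
    specialize (Hs z0); rewrite H0 in Hs; specialize (Hs ltac:(lra)).
    eapply is_cseries_unique; [apply Hs|].
    assert (E : csum (fun j => a (S m + j)%nat * (z0 - z0) ^ j) 0 = a (S m)).
    { simpl; rewrite Nat.add_0_r; ring. }
    rewrite <- E; apply is_cseries_zero_from; intros [|k] Hk; [lia|]; simpl; ring.
  + intros z Hz.
    assert (E := is_cseries_drop _ _ m (Hf z Hz)).
    assert (E2 := is_cseries_scal ((z - z0) ^ S m) _ _ (Hs z Hz)).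
    apply (is_cseries_ext _ (fun k => a (S m + k)%nat * (z - z0) ^ (S m + k))) in E2.
    * rewrite <- (is_cseries_unique _ _ _ E E2); ring.
    * intros k; rewrite Cpow_add_r; ring.
Qed.

Lemma csum_geom (q : C) (n : nat) :
  (1 - q) * csum (fun k => q ^ k) n = 1 - q ^ S n.
Proof. induction n as [|n IH]; simpl; [|rewrite Cmult_plus_distr_l, IH; simpl]; ring. Qed.

Lemma is_cseries_geom (q : C) :
  (Cmod q < 1)%R -> is_cseries (fun k => q ^ k) (/ (1 - q)).
Proof.
intros Hq.
assert (Hn : 1 - q <> 0).
{ intros E; replace q with (1 - (1 - q)) in Hq by ring; rewrite E in Hq.
  replace (1 - 0) with (RtoC 1) in Hq by ring; rewrite Cmod_1 in Hq; lra. }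
assert (Hm := proj1 (Cmod_gt_0 _) Hn).
apply is_cseries_eps; intros eps He.
assert (Ha : (Rabs (Cmod q) < 1)%R) by (rewrite Rabs_pos_eq; auto; apply Cmod_ge_0).
destruct (pow_lt_1_zero _ Ha (eps * Cmod (1 - q))%R) as [N HN].
{ apply Rmult_lt_0_compat; lra. }
exists N; intros n Hle; specialize (HN (S n) ltac:(lia)).
replace (csum (fun k => q ^ k) n - / (1 - q)) with (- (q ^ S n) * / (1 - q)).
- rewrite Cmod_mult, Cmod_opp, Cmod_inv, Cmod_pow by auto.
  rewrite Rabs_pos_eq in HN by (apply pow_le, Cmod_ge_0).
  apply Rmult_lt_reg_r with (Cmod (1 - q)); auto.
  rewrite Rmult_assoc, Rinv_l by lra; lra.
- replace (csum (fun k => q ^ k) n)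
    with (/ (1 - q) * ((1 - q) * csum (fun k => q ^ k) n)) by (field; auto).
  rewrite csum_geom; field; auto.
Qed.

(** Neumann series: [f = c (1 - q)] with [c = f z0] and [q z0 = 0], and [q] has norm at most 1/2 on
    a small enough disc. *)
Lemma majorized_inv (f : C -> C) (z0 : C) (r M : R) :
  (0 < r)%R -> majorized f z0 r M -> f z0 <> 0 ->
  exists r' M', (0 < r')%R /\ majorized (fun z => / f z) z0 r' M'.
Proof.
intros Hr Hf H0; assert (HM := majorized_nonneg _ _ _ _ Hf).
destruct Hf as [a [Ha Hf]].
destruct (majorized_factor f z0 r M a 0 Hr Ha Hf) as [g [Hg [_ Hfg]]].
assert (Hc := proj1 (Cmod_gt_0 _) H0); set (c := f z0) in *.
assert (E0 : a 0%nat = c).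
{ unfold c; rewrite (Hfg z0); simpl;
    replace (z0 - z0) with (RtoC 0) by ring; [ring|rewrite Cmod_0; lra]. }
set (N := (M / r ^ 1)%R) in *.
assert (HN : (0 <= N)%R) by (apply (majorized_nonneg _ _ _ _ Hg)).
(* This radius makes [r' * N / Cmod c] at most 1/2; [N + 1] keeps the denominator positive when [N]
   is 0. *)
set (r' := Rmin r (Cmod c / (2 * (N + 1)))%R).
assert (Hr' : (0 < r')%R).
{ apply Rmin_glb_lt; auto; apply Rdiv_lt_0_compat; lra. }
assert (Hr1 : (r' <= r)%R) by apply Rmin_l.
assert (Hr2 : (r' * N / Cmod c <= / 2)%R).
{ apply Rmult_le_reg_r with (Cmod c); auto.
  replace (r' * N / Cmod c * Cmod c)%R with (r' * N)%R by (field; lra).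
  apply Rle_trans with (Cmod c / (2 * (N + 1)) * N)%R.
  - apply Rmult_le_compat_r; auto; apply Rmin_r.
  - apply Rmult_le_reg_r with (2 * (N + 1))%R; [lra|].
    replace (Cmod c / (2 * (N + 1)) * N * (2 * (N + 1)))%R with (Cmod c * N)%R
      by (field; lra).
    replace (/ 2 * Cmod c * (2 * (N + 1)))%R with (Cmod c * (N + 1))%R by field.
    apply Rmult_le_compat_l; lra. }
set (q := fun z => - / c * ((z - z0) * g z)).
assert (Hq : majorized q z0 r' (/ 2)).
{ apply majorized_le with (Cmod (- / c) * (r' * N))%R.
  - rewrite Cmod_opp, Cmod_inv by auto; unfold Rdiv in Hr2.
    rewrite Rmult_comm; auto.
  - apply majorized_scal, majorized_shift; [lra|].
    apply majorized_shrink with r; auto; lra. }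
exists r', (Cmod (/ c) * 2)%R; split; auto.
apply majorized_ext with (fun z => / c * / (1 - q z)).
- intros z Hz; rewrite Hfg by lra; simpl csum; rewrite E0.
  assert (Hqz := majorized_at _ _ _ _ _ Hq Hz).
  assert (Hn : 1 - q z <> 0).
  { intros E; replace (q z) with (1 - (1 - q z)) in Hqz by ring; rewrite E in Hqz.
    replace (1 - 0) with (RtoC 1) in Hqz by ring; rewrite Cmod_1 in Hqz; lra. }
  replace (c * 1 + (z - z0) ^ 1 * g z) with (c * (1 - q z)).
  + field; auto.
  + unfold q; simpl; field; auto.
- apply majorized_scal.
  apply majorized_series with (f := fun k z => q z ^ k) (Mk := fun k => ((/ 2) ^ k)%R);
    auto.
  + intros k; apply majorized_pow; auto.
  + intros n; assert (HS : (0 < (/ 2) ^ S n)%R) by (apply pow_lt; lra).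
    rewrite tech3 by lra; apply Rmult_le_reg_r with (1 - / 2)%R; [lra|].
    unfold Rdiv; rewrite Rmult_assoc, Rinv_l by lra; lra.
  + intros z Hz; apply is_cseries_geom.
    assert (Hqz := majorized_at _ _ _ _ _ Hq Hz); lra.
Qed.

(** * Comparison with the power series of the definitions *)

Lemma pow_n_Cpow (z : C) (n : nat) : @pow_n C_AbsRing z n = z ^ n.
Proof. induction n as [|n IH]; simpl; [|rewrite IH]; reflexivity. Qed.

Lemma is_pseries_C (a : nat -> C) (z l : C) :
  @is_pseries C_AbsRing C_NormedModule a z l <-> is_cseries (fun j => a j * z ^ j) l.
Proof.
assert (E : forall k, @scal C_AbsRing C_NormedModule (@pow_n C_AbsRing z k) (a k)
  = a k * z ^ k).
{ intros k; rewrite (pow_n_Cpow z k); apply Cmult_comm. }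
split; apply is_cseries_ext; intros k; [|symmetry]; apply E.
Qed.

(** Convergence at one point at distance r/2 bounds the terms there; at radius r/4 they are then
    dominated by a geometric series of ratio 1/2. *)
Lemma holomorphic_majorized (f : C -> C) (z0 : C) :
  holomorphic_at f z0 <-> exists r M, (0 < r)%R /\ majorized f z0 r M.
Proof.
split.
- intros [a [r [Hr H]]].
  assert (Hz : z0 + RtoC (r / 2) - z0 = RtoC (r / 2)) by ring.
  assert (Hs : is_cseries (fun j => a j * RtoC (r / 2) ^ j) (f (z0 + RtoC (r / 2)))).
  { assert (Hs := H (z0 + RtoC (r / 2))); rewrite is_pseries_C, Hz in Hs.
    apply Hs; rewrite Cmod_R, Rabs_pos_eq; lra. }
  rewrite is_cseries_eps in Hs; destruct (Hs 1%R ltac:(lra)) as [N HN].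
  set (u := fun j => a j * RtoC (r / 2) ^ j) in *.
  (* Up to [N] a term is at most the finite sum; beyond, it is a difference of two partial sums
     within 1 of the limit, hence the 2. *)
  set (K := (sum_f_R0 (fun j => Cmod (u j)) N + 2)%R).
  assert (Hp : forall n, (0 <= sum_f_R0 (fun j => Cmod (u j)) n)%R).
  { intros n; apply cond_pos_sum; intros i; apply Cmod_ge_0. }
  assert (HK : forall j, (Cmod (u j) <= K)%R).
  { intros j; destruct (le_lt_dec j N) as [Hj|Hj].
    - assert (T := term_le_sum (fun j => Cmod (u j)) j N (fun k => Cmod_ge_0 _) Hj).
      unfold K; cbv beta in T; lra.
    - destruct j as [|j]; [lia|].
      assert (T1 := HN (S j) ltac:(lia)); assert (T2 := HN j ltac:(lia)).
      set (l := f (z0 + RtoC (r / 2))) in *.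
      replace (u (S j)) with ((csum u (S j) - l) + - (csum u j - l)) by (simpl; ring).
      eapply Rle_trans; [apply Cmod_triangle|]; rewrite Cmod_opp.
      specialize (Hp N); unfold K; lra. }
  exists (r / 4)%R, (K * 2)%R; split; [lra|]; exists a; split.
  + intros n; apply Rle_trans with (sum_f_R0 (fun j => K * (/ 2) ^ j)%R n).
    * apply sum_f_R0_le; intros j.
      replace (Cmod (a j) * (r / 4) ^ j)%R with (Cmod (u j) * (/ 2) ^ j)%R.
      -- apply Rmult_le_compat_r; auto; apply pow_le; lra.
      -- unfold u; rewrite Cmod_mult, Cmod_pow, Cmod_R, Rabs_pos_eq by lra.
         rewrite Rmult_assoc, <- Rpow_mult_distr; do 2 f_equal; field.
    * rewrite sum_scal; apply Rmult_le_compat_l; [specialize (Hp N); unfold K; lra|].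
      assert (HS : (0 < (/ 2) ^ S n)%R) by (apply pow_lt; lra).
      rewrite tech3 by lra; apply Rmult_le_reg_r with (1 - / 2)%R; [lra|].
      unfold Rdiv; rewrite Rmult_assoc, Rinv_l by lra; lra.
  + intros z Hz'; apply (proj1 (is_pseries_C _ _ _)), H; lra.
- intros [r [M [Hr [a [_ Hf]]]]]; exists a, r; split; auto.
  intros z Hz; apply is_pseries_C, Hf; lra.
Qed.

(** * Holomorphic and meromorphic functions *)

Definition near (z0 : C) (P : C -> Prop) : Prop :=
  exists r : R, (0 < r)%R /\ forall z, (Cmod (z - z0) < r)%R -> P z.

Lemma Cmod_minus_diag (z : C) : Cmod (z - z) = 0%R.
Proof. replace (z - z) with (RtoC 0) by ring; apply Cmod_0. Qed.


Lemma near_mono (z0 : C) (P Q : C -> Prop) :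
  (forall z, P z -> Q z) -> near z0 P -> near z0 Q.
Proof. intros H [r [Hr Hp]]; exists r; auto. Qed.

Lemma near_and (z0 : C) (P Q : C -> Prop) :
  near z0 P -> near z0 Q -> near z0 (fun z => P z /\ Q z).
Proof.
intros [r [Hr H]] [r' [Hr' H']]; exists (Rmin r r'); split.
- apply Rmin_glb_lt; auto.
- intros z Hz; split; [apply H|apply H']; eapply Rlt_le_trans; eauto;
    [apply Rmin_l|apply Rmin_r].
Qed.

Lemma near_near (z0 : C) (P : C -> Prop) :
  near z0 P -> near z0 (fun z => near z P).
Proof.
intros [r [Hr H]]; exists r; split; auto; intros z Hz.
exists (r - Cmod (z - z0))%R; split; [lra|]; intros w Hw; apply H.
replace (w - z0) with ((w - z) + (z - z0)) by ring.
eapply Rle_lt_trans; [apply Cmod_triangle|]; lra.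
Qed.

Lemma punctured_near_iff (z0 : C) (P : C -> Prop) :
  punctured_near z0 P <-> near z0 (fun z => z <> z0 -> P z).
Proof. split; intros [r [Hr H]]; exists r; auto. Qed.

Lemma near_punctured (z0 : C) (P : C -> Prop) : near z0 P -> punctured_near z0 P.
Proof. intros [r [Hr H]]; exists r; auto. Qed.

Lemma punctured_mono (z0 : C) (P Q : C -> Prop) :
  (forall z, P z -> Q z) -> punctured_near z0 P -> punctured_near z0 Q.
Proof. intros H [r [Hr Hp]]; exists r; auto. Qed.

Lemma punctured_and (z0 : C) (P Q : C -> Prop) :
  punctured_near z0 P -> punctured_near z0 Q ->
  punctured_near z0 (fun z => P z /\ Q z).
Proof.
rewrite !punctured_near_iff; intros H H'.
apply (near_mono _ _ _ (fun z H => fun h => conj (proj1 H h) (proj2 H h))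
  (near_and _ _ _ H H')).
Qed.

Lemma punctured_neq (z0 : C) : punctured_near z0 (fun z => z <> z0).
Proof. exists 1%R; split; auto; lra. Qed.

Lemma near_neq (z0 z : C) : z <> z0 -> near z (fun w => w <> z0).
Proof.
intros H; exists (Cmod (z0 - z)); split.
- apply Cmod_gt_0; intros E; apply H; symmetry; apply Ceq_minus; auto.
- intros w Hw ->; lra.
Qed.

(** Points of a punctured disc are interior to it, so an identity off [z0] becomes a local
    hypothesis at each neighbouring point. *)
Lemma punctured_punctured (z0 : C) (P : C -> Prop) :
  punctured_near z0 P -> punctured_near z0 (fun z => near z P).
Proof.
rewrite !punctured_near_iff; intros H; apply near_near in H.
eapply near_mono; [|apply H]; intros z Hz Hne.
eapply near_mono; [|apply near_and; [apply Hz|apply (near_neq z0 z Hne)]].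
simpl; tauto.
Qed.

Lemma near_of_punctured (z0 : C) (P : C -> Prop) :
  P z0 -> punctured_near z0 P -> near z0 P.
Proof.
rewrite punctured_near_iff; intros H0; apply near_mono; intros z Hz.
destruct (classic (z = z0)) as [->|Hne]; auto.
Qed.

Lemma punctured_exists (z0 : C) (P : C -> Prop) :
  punctured_near z0 P -> exists z, P z.
Proof.
intros [r [Hr H]]; exists (z0 + RtoC (r / 2)); apply H.
- intros E; assert (E' : RtoC (r / 2) = RtoC 0).
  { replace (RtoC (r / 2)) with (z0 + RtoC (r / 2) - z0) by ring; rewrite E; ring. }
  apply RtoC_inj in E'; lra.
- replace (z0 + RtoC (r / 2) - z0) with (RtoC (r / 2)) by ring.
  rewrite Cmod_R, Rabs_pos_eq; lra.
Qed.

Lemma holomorphic_ext (f g : C -> C) (z0 : C) :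
  near z0 (fun z => f z = g z) -> holomorphic_at f z0 -> holomorphic_at g z0.
Proof.
intros [r [Hr E]] [a [r' [Hr' H]]]; exists a, (Rmin r r'); split.
- apply Rmin_glb_lt; auto.
- intros z Hz; assert (T1 := Rmin_l r r'); assert (T2 := Rmin_r r r').
  rewrite <- E; [apply H|]; lra.
Qed.

Lemma majorized_holomorphic (f : C -> C) (z0 : C) (r M : R) :
  (0 < r)%R -> majorized f z0 r M -> holomorphic_at f z0.
Proof. intros Hr H; apply holomorphic_majorized; eauto. Qed.

Lemma holomorphic_const (c z0 : C) : holomorphic_at (fun _ => c) z0.
Proof. apply majorized_holomorphic with 1%R (Cmod c); [lra|apply majorized_const]. Qed.

Lemma holomorphic_sub (p z0 : C) : holomorphic_at (fun z => z - p) z0.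
Proof.
apply majorized_holomorphic with 1%R (Cmod (z0 - p) + 1)%R; [lra|].
apply majorized_sub; lra.
Qed.

Lemma holomorphic_majorized2 (f g : C -> C) (z0 : C) :
  holomorphic_at f z0 -> holomorphic_at g z0 ->
  exists r M N, (0 < r)%R /\ majorized f z0 r M /\ majorized g z0 r N.
Proof.
rewrite !holomorphic_majorized; intros [r [M [Hr H]]] [r' [N [Hr' H']]].
exists (Rmin r r'), M, N; assert (P := Rmin_glb_lt _ _ _ Hr Hr').
assert (T1 := Rmin_l r r'); assert (T2 := Rmin_r r r').
split; [auto|split]; eapply majorized_shrink; eauto; lra.
Qed.

Lemma holomorphic_plus (f g : C -> C) (z0 : C) :
  holomorphic_at f z0 -> holomorphic_at g z0 ->
  holomorphic_at (fun z => f z + g z) z0.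
Proof.
intros Hf Hg; destruct (holomorphic_majorized2 f g z0 Hf Hg) as [r [M [N [Hr [H H']]]]].
apply majorized_holomorphic with r (M + N)%R; auto.
apply majorized_plus; auto; lra.
Qed.

Lemma holomorphic_mult (f g : C -> C) (z0 : C) :
  holomorphic_at f z0 -> holomorphic_at g z0 ->
  holomorphic_at (fun z => f z * g z) z0.
Proof.
intros Hf Hg; destruct (holomorphic_majorized2 f g z0 Hf Hg) as [r [M [N [Hr [H H']]]]].
apply majorized_holomorphic with r (M * N)%R; auto.
apply majorized_mult; auto.
Qed.

Lemma holomorphic_pow (f : C -> C) (z0 : C) (n : nat) :
  holomorphic_at f z0 -> holomorphic_at (fun z => f z ^ n) z0.
Proof.
intros H; induction n as [|n IH]; simpl; [apply holomorphic_const|].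
apply holomorphic_mult; auto.
Qed.

Lemma holomorphic_inv (f : C -> C) (z0 : C) :
  holomorphic_at f z0 -> f z0 <> 0 -> holomorphic_at (fun z => / f z) z0.
Proof.
intros Hf H0; apply holomorphic_majorized in Hf; destruct Hf as [r [M [Hr Hf]]].
destruct (majorized_inv _ _ _ _ Hr Hf H0) as [r' [M' [Hr' H]]].
eapply majorized_holomorphic; eauto.
Qed.

Lemma holomorphic_affine (f : C -> C) (al be z0 : C) :
  al <> 0 -> holomorphic_at f (al * z0 + be) ->
  holomorphic_at (fun z => f (al * z + be)) z0.
Proof.
intros Hal Hf; apply holomorphic_majorized in Hf; destruct Hf as [r [M [Hr Hf]]].
eapply majorized_holomorphic, majorized_affine; eauto.
apply Rdiv_lt_0_compat; auto; apply Cmod_gt_0; auto.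
Qed.

Lemma holomorphic_near (f : C -> C) (z0 : C) :
  holomorphic_at f z0 -> near z0 (holomorphic_at f).
Proof.
intros Hf; apply holomorphic_majorized in Hf; destruct Hf as [r [M [Hr Hf]]].
exists r; split; auto; intros z Hz.
apply majorized_holomorphic with (r - Cmod (z - z0))%R M; [lra|].
apply majorized_recenter with z0 r; auto; lra.
Qed.

Lemma holomorphic_continuous (f : C -> C) (z0 : C) (eps : R) :
  (0 < eps)%R -> holomorphic_at f z0 ->
  near z0 (fun z => (Cmod (f z - f z0) < eps)%R).
Proof.
intros He Hf; apply holomorphic_majorized in Hf; destruct Hf as [r [M [Hr Hf]]].
destruct Hf as [a [Ha Hf]].
destruct (majorized_factor f z0 r M a 0 Hr Ha Hf) as [g [Hg [_ Hfg]]].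
set (N := (M / r ^ 1)%R) in *.
assert (HN : (0 <= N)%R) by (apply (majorized_nonneg _ _ _ _ Hg)).
exists (Rmin r (eps / (N + 1)))%R.
assert (T1 := Rmin_l r (eps / (N + 1))); assert (T2 := Rmin_r r (eps / (N + 1))).
split; [apply Rmin_glb_lt; auto; apply Rdiv_lt_0_compat; lra|].
intros z Hz; rewrite (Hfg z) by lra; rewrite (Hfg z0) by (rewrite Cmod_minus_diag; lra).
replace (csum (fun j => a j * (z - z0) ^ j) 0 + (z - z0) ^ 1 * g z -
  (csum (fun j => a j * (z0 - z0) ^ j) 0 + (z0 - z0) ^ 1 * g z0))
  with ((z - z0) * g z) by (simpl; ring).
rewrite Cmod_mult.
assert (Hgz := majorized_at _ _ z _ _ Hg ltac:(lra)).
apply Rle_lt_trans with (Cmod (z - z0) * (N + 1))%R.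
- apply Rmult_le_compat_l; [apply Cmod_ge_0|lra].
- apply Rlt_le_trans with (eps / (N + 1) * (N + 1))%R; [|right; field; lra].
  apply Rmult_lt_compat_r; lra.
Qed.

Lemma holomorphic_nonzero_near (f : C -> C) (z0 : C) :
  holomorphic_at f z0 -> f z0 <> 0 -> near z0 (fun z => f z <> 0).
Proof.
intros Hf H0; assert (Hm := proj1 (Cmod_gt_0 _) H0).
eapply near_mono; [|apply (holomorphic_continuous f z0 _ Hm Hf)].
intros z Hz E; simpl in Hz; rewrite E in Hz.
replace (0 - f z0) with (- f z0) in Hz by ring; rewrite Cmod_opp in Hz; lra.
Qed.

(** Holds by continuity; it makes the filling of removable singularities unambiguous. *)
Lemma holomorphic_punctured_eq (f g : C -> C) (z0 : C) :
  holomorphic_at f z0 -> holomorphic_at g z0 ->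
  punctured_near z0 (fun z => f z = g z) -> f z0 = g z0.
Proof.
intros Hf Hg H; apply NNPP; intros Hne.
assert (Hd : holomorphic_at (fun z => f z + - (1) * g z) z0).
{ apply holomorphic_plus, holomorphic_mult; auto; apply holomorphic_const. }
apply holomorphic_nonzero_near in Hd.
- apply near_punctured in Hd.
  destruct (punctured_exists _ _ (punctured_and _ _ _ H Hd)) as [z [E Hz]].
  apply Hz; rewrite E; ring.
- intros E; apply Hne, Ceq_minus; rewrite <- E; ring.
Qed.

(** The order of the zero is the least index of a nonzero coefficient. *)
Lemma holomorphic_factor (f : C -> C) (z0 : C) :
  holomorphic_at f z0 ->
  near z0 (fun z => f z = 0) \/
  exists k h, holomorphic_at h z0 /\ h z0 <> 0 /\
    near z0 (fun z => f z = (z - z0) ^ k * h z).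
Proof.
intros Hf0; assert (Hf := Hf0).
apply holomorphic_majorized in Hf; destruct Hf as [r [M [Hr Hf]]].
destruct Hf as [a [Ha Hf]].
destruct (classic (exists k, a k <> 0)) as [Hex|Hno].
- right.
  destruct (dec_inh_nat_subset_has_unique_least_element (fun k => a k <> 0)
    (fun k => classic _) Hex) as [k [[Hk Hleast] _]].
  assert (Hz : forall j, (j < k)%nat -> a j = 0).
  { intros j Hj; apply NNPP; intros Hn; specialize (Hleast j Hn); lia. }
  (* [majorized_factor] splits off at least the constant term, so order 0 is treated apart. *)
  destruct k as [|m].
  + exists 0%nat, f; split; [auto|split].
    * intros E; apply Hk; rewrite <- E.
      destruct (majorized_factor f z0 r M a 0 Hr Ha Hf) as [g [_ [_ Hfg]]].
      rewrite Hfg by (rewrite Cmod_minus_diag; lra); simpl; ring.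
    * exists 1%R; split; [lra|]; intros; simpl; ring.
  + destruct (majorized_factor f z0 r M a m Hr Ha Hf) as [g [Hg [Hg0 Hfg]]].
    exists (S m), g; split; [eapply majorized_holomorphic; eauto|split].
    * rewrite Hg0; auto.
    * exists r; split; auto; intros z Hz'; rewrite Hfg by lra.
      replace (csum (fun j => a j * (z - z0) ^ j) m) with (csum (fun _ => 0) m).
      -- replace (csum (fun _ => 0) m) with (RtoC 0); [ring|].
         clear; induction m as [|m IH]; simpl; [|rewrite <- IH]; ring.
      -- apply csum_ext; intros j Hj; rewrite Hz by lia; ring.
- left; exists r; split; auto; intros z Hz.
  eapply is_cseries_unique; [apply Hf; lra|].
  eapply is_cseries_ext with (fun j => 0 * a j).
  + intros k; replace (a k) with (RtoC 0); [ring|].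
    symmetry; apply NNPP; intros Hn; apply Hno; exists k; auto.
  + replace (RtoC 0) with (0 * f z0) by ring; apply is_cseries_ext with
      (fun j => 0 * (a j * (z0 - z0) ^ j)).
    * intros k; ring.
    * apply is_cseries_scal, Hf; rewrite Cmod_minus_diag; lra.
Qed.

(* Unlike [pole_at], this leaves the value of [f] at [z0] arbitrary and allows
   removable singularities, which makes the class an algebra. *)
Definition weakly_meromorphic_at (f : C -> C) (z0 : C) : Prop :=
  exists (m : nat) (g : C -> C), holomorphic_at g z0 /\
    punctured_near z0 (fun z => f z = g z / (z - z0) ^ m).

Lemma Cminus_neq_0 (z w : C) : z <> w -> z - w <> 0.
Proof. intros H E; apply H, Ceq_minus; auto. Qed.

Lemma weakly_meromorphic_ext (f g : C -> C) (z0 : C) :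
  punctured_near z0 (fun z => f z = g z) ->
  weakly_meromorphic_at f z0 -> weakly_meromorphic_at g z0.
Proof.
intros H [m [h [Hh E]]]; exists m, h; split; auto.
eapply punctured_mono; [|apply (punctured_and _ _ _ H E)].
intros z [E1 E2]; congruence.
Qed.

Lemma holomorphic_weakly_meromorphic (f : C -> C) (z0 : C) :
  holomorphic_at f z0 -> weakly_meromorphic_at f z0.
Proof.
intros H; exists 0%nat, f; split; auto.
exists 1%R; split; [lra|]; intros; simpl; field.
Qed.

Lemma meromorphic_weakly (f : C -> C) (z0 : C) :
  meromorphic f -> weakly_meromorphic_at f z0.
Proof.
intros H; destruct (H z0) as [H0|[m [g [_ [Hg [_ E]]]]]].
- now apply holomorphic_weakly_meromorphic.
- exists m, g; auto.
Qed.

Lemma weakly_meromorphic_plus (f g : C -> C) (z0 : C) :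
  weakly_meromorphic_at f z0 -> weakly_meromorphic_at g z0 ->
  weakly_meromorphic_at (fun z => f z + g z) z0.
Proof.
intros [m [F [HF Ef]]] [n [G [HG Eg]]].
exists (m + n)%nat, (fun z => F z * (z - z0) ^ n + G z * (z - z0) ^ m); split.
- apply holomorphic_plus; apply holomorphic_mult; auto;
    apply holomorphic_pow, holomorphic_sub.
- eapply punctured_mono; [|apply (punctured_and _ _ _ (punctured_neq z0)
    (punctured_and _ _ _ Ef Eg))].
  intros z [Hz [E1 E2]]; rewrite E1, E2, Cpow_add_r.
  assert (Hn := Cminus_neq_0 _ _ Hz).
  field; split; apply Cpow_nz; auto.
Qed.

Lemma weakly_meromorphic_mult (f g : C -> C) (z0 : C) :
  weakly_meromorphic_at f z0 -> weakly_meromorphic_at g z0 ->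
  weakly_meromorphic_at (fun z => f z * g z) z0.
Proof.
intros [m [F [HF Ef]]] [n [G [HG Eg]]].
exists (m + n)%nat, (fun z => F z * G z); split.
- apply holomorphic_mult; auto.
- eapply punctured_mono; [|apply (punctured_and _ _ _ (punctured_neq z0)
    (punctured_and _ _ _ Ef Eg))].
  intros z [Hz [E1 E2]]; rewrite E1, E2, Cpow_add_r.
  assert (Hn := Cminus_neq_0 _ _ Hz).
  field; split; apply Cpow_nz; auto.
Qed.

Lemma weakly_meromorphic_inv_sub (p z0 : C) :
  weakly_meromorphic_at (fun z => / (z - p)) z0.
Proof.
destruct (classic (z0 = p)) as [->|Hne].
- exists 1%nat, (fun _ => 1); split; [apply holomorphic_const|].
  eapply punctured_mono; [|apply punctured_neq].
  intros z Hz; simpl; field; apply Cminus_neq_0; auto.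
- apply holomorphic_weakly_meromorphic, holomorphic_inv; [apply holomorphic_sub|].
  apply Cminus_neq_0; auto.
Qed.

Lemma weakly_meromorphic_affine (f : C -> C) (al be z0 : C) :
  al <> 0 -> weakly_meromorphic_at f (al * z0 + be) ->
  weakly_meromorphic_at (fun z => f (al * z + be)) z0.
Proof.
intros Hal [m [g [Hg [r [Hr E]]]]].
assert (Hm := proj1 (Cmod_gt_0 _) Hal).
exists m, (fun z => / al ^ m * g (al * z + be)); split.
- apply holomorphic_mult; [apply holomorphic_const|].
  apply holomorphic_affine; auto.
- exists (r / Cmod al)%R; split; [apply Rdiv_lt_0_compat; auto|].
  intros z Hz Hlt.
  assert (Ed : al * z + be - (al * z0 + be) = al * (z - z0)) by ring.
  assert (Hn := Cminus_neq_0 _ _ Hz).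
  rewrite E, Ed, Cpow_mult_l.
  + field; split; apply Cpow_nz; auto.
  + intros E'; apply Hz; apply Ceq_minus in E'; rewrite Ed in E'.
    apply Ceq_minus; replace (z - z0) with (/ al * (al * (z - z0))) by (field; auto).
    rewrite E'; ring.
  + rewrite Ed, Cmod_mult; apply Rmult_lt_compat_l with (r := Cmod al) in Hlt; auto.
    replace (Cmod al * (r / Cmod al))%R with r in Hlt by (field; lra); auto.
Qed.

Lemma weakly_meromorphic_csum (f : nat -> C -> C) (z0 : C) (n : nat) :
  (forall k, (k <= n)%nat -> weakly_meromorphic_at (f k) z0) ->
  weakly_meromorphic_at (fun z => csum (fun k => f k z) n) z0.
Proof.
induction n as [|n IH]; intros H; simpl; [apply H; auto|].
apply weakly_meromorphic_plus; auto.
Qed.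

Lemma weakly_meromorphic_holomorphic_near (f : C -> C) (z0 : C) :
  weakly_meromorphic_at f z0 -> punctured_near z0 (holomorphic_at f).
Proof.
intros [m [g [Hg E]]].
apply punctured_punctured in E; apply holomorphic_near, near_punctured in Hg.
eapply punctured_mono; [|apply (punctured_and _ _ _ (punctured_neq z0)
    (punctured_and _ _ _ E Hg))].
intros z [Hz [E1 E2]]; apply holomorphic_ext with (fun z => g z * / (z - z0) ^ m).
- eapply near_mono; [|apply E1]; auto.
- apply holomorphic_mult; auto; apply holomorphic_inv.
  + apply holomorphic_pow, holomorphic_sub.
  + apply Cpow_nz, Cminus_neq_0; auto.
Qed.

(** The order is kept as two natural exponents, one for the numerator and one for the denominator,
    since their difference may be negative. *)
Lemma weakly_meromorphic_order (f : C -> C) (z0 : C) :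
  weakly_meromorphic_at f z0 ->
  punctured_near z0 (fun z => f z = 0) \/
  exists m k h, holomorphic_at h z0 /\ h z0 <> 0 /\
    punctured_near z0 (fun z => f z = (z - z0) ^ k * h z / (z - z0) ^ m).
Proof.
intros [m [g [Hg E]]]; destruct (holomorphic_factor g z0 Hg) as [H|[k [h [Hh [H0 H]]]]];
  apply near_punctured in H.
- left; eapply punctured_mono; [|apply (punctured_and _ _ _ (punctured_neq z0)
    (punctured_and _ _ _ E H))].
  intros z [Hz [E1 E2]]; rewrite E1, E2; field.
  apply Cpow_nz, Cminus_neq_0; auto.
- right; exists m, k, h; split; [auto|split; auto].
  eapply punctured_mono; [|apply (punctured_and _ _ _ E H)].
  intros z [E1 E2]; rewrite E1, E2; auto.
Qed.

Lemma weakly_meromorphic_dichotomy (f : C -> C) (z0 : C) :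
  weakly_meromorphic_at f z0 ->
  punctured_near z0 (fun z => f z = 0) \/ punctured_near z0 (fun z => f z <> 0).
Proof.
intros Hf; destruct (weakly_meromorphic_order f z0 Hf) as [H|[m [k [h [Hh [H0 H]]]]]];
  [left; auto|right].
apply holomorphic_nonzero_near, near_punctured in Hh; auto.
eapply punctured_mono; [|apply (punctured_and _ _ _ (punctured_neq z0)
    (punctured_and _ _ _ H Hh))].
intros z [Hz [E1 E2]]; assert (Hn := Cminus_neq_0 _ _ Hz); rewrite E1.
repeat apply Cmult_neq_0; auto; [apply Cpow_nz; auto|].
intros E; assert (Hp := Cpow_nz _ m Hn); apply C1_nz.
rewrite <- (Cinv_r _ Hp), E; ring.
Qed.

(** Identity theorem by continuity along the segment. The parameters up to which [f] vanishes
    locally have a supremum; the dichotomy shows that it is attained, and openness pushes it to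
    1. *)
Lemma weakly_meromorphic_zero_segment (f : C -> C) (z1 z0 : C) :
  (forall t, (0 <= t <= 1)%R -> weakly_meromorphic_at f (z1 + RtoC t * (z0 - z1))) ->
  punctured_near z1 (fun z => f z = 0) -> punctured_near z0 (fun z => f z = 0).
Proof.
intros Hf H1; destruct (classic (z0 = z1)) as [->|Hne]; auto.
assert (HD := proj1 (Cmod_gt_0 _) (Cminus_neq_0 _ _ Hne)); set (D := Cmod (z0 - z1)) in *.
set (ga := fun t : R => z1 + RtoC t * (z0 - z1)) in *.
set (P := fun t => punctured_near (ga t) (fun z => f z = 0)).
assert (Hga : forall t u, Cmod (ga t - ga u) = (Rabs (t - u) * D)%R).
{ intros t u; unfold ga; replace (z1 + RtoC t * (z0 - z1) - (z1 + RtoC u * (z0 - z1)))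
    with (RtoC (t - u) * (z0 - z1)) by (rewrite RtoC_minus; ring).
  now rewrite Cmod_mult, Cmod_R. }
assert (P0 : P 0%R).
{ unfold P, ga; replace (z1 + RtoC 0 * (z0 - z1)) with z1 by ring; auto. }
(* Since [D > 0], the parametrization is injective and turns a punctured disc into a punctured
   interval. *)
assert (Hclose : forall t (Q : C -> Prop), punctured_near (ga t) Q ->
  exists d, (0 < d)%R /\ forall u, u <> t -> (Rabs (u - t) < d)%R -> Q (ga u)).
{ intros t Q [r [Hr H]]; exists (r / D)%R; split; [apply Rdiv_lt_0_compat; auto|].
  intros u Hu Hlt; apply H.
  - intros E; assert (Hz := Hga u t); rewrite E, Cmod_minus_diag in Hz.
    symmetry in Hz; apply Rmult_integral in Hz; destruct Hz as [Hz|Hz]; [|lra].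
    apply Hu; apply Rminus_diag_uniq; apply Rabs_eq_0; auto.
  - rewrite Hga; apply Rmult_lt_compat_r with (r := D) in Hlt; auto.
    replace (r / D * D)%R with r in Hlt by (field; lra); auto. }
destruct (completeness (fun t => (0 <= t <= 1)%R /\
    forall u, (0 <= u <= t)%R -> P u)) as [s [Hs1 Hs2]].
- exists 1%R; intros t [Ht _]; lra.
- exists 0%R; split; [lra|]; intros u Hu; replace u with 0%R by lra; auto.
- assert (Hs0 : (0 <= s)%R).
  { apply Hs1; split; [lra|]; intros u Hu; replace u with 0%R by lra; auto. }
  assert (Hs3 : (s <= 1)%R) by (apply Hs2; intros t [Ht _]; lra).
  assert (Hbelow : forall u, (0 <= u < s)%R -> P u).
  { intros u Hu; apply NNPP; intros Hn.
    assert (s <= u)%R; [|lra].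
    apply Hs2; intros t [Ht HP]; apply Rnot_lt_le; intros Hlt; apply Hn, HP; lra. }
  assert (Ps : P s).
  { destruct (Req_dec s 0) as [->|Hs]; auto.
    destruct (weakly_meromorphic_dichotomy f (ga s)) as [H|H]; auto.
    - apply Hf; lra.
    - exfalso; apply punctured_punctured in H; destruct (Hclose _ _ H) as [d [Hd Hu]].
      (* A parameter just below [s], kept nonnegative: near [ga u] the function would be both zero
         and nonzero. *)
      set (u := Rmax 0 (s - d / 2)).
      assert (Hu1 : (0 <= u < s)%R).
      { split; [apply Rmax_l|apply Rmax_lub_lt; lra]. }
      assert (Hu2 : (s - d / 2 <= u)%R) by apply Rmax_r.
      assert (HN : near (ga u) (fun z => f z <> 0)).
      { apply Hu; [lra|]; rewrite Rabs_left; lra. }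
      apply near_punctured in HN.
      destruct (punctured_exists _ _ (punctured_and _ _ _ HN (Hbelow u Hu1)))
        as [z [Hz1 Hz2]]; auto. }
  assert (Hs : s = 1%R).
  (* Otherwise local vanishing would extend to some [t > s]. *)
  { apply NNPP; intros Hn; assert (Ps' := punctured_punctured _ _ Ps).
    destruct (Hclose _ _ Ps') as [d [Hd Hu]].
    set (t := Rmin 1 (s + d / 2)).
    assert (Ht : (t <= 1)%R) by apply Rmin_l.
    assert (Ht' : (t <= s + d / 2)%R) by apply Rmin_r.
    assert (s < t)%R by (apply Rmin_glb_lt; lra).
    assert (t <= s)%R; [|lra]; apply Hs1; split; [lra|]; intros u Hut.
    destruct (Rtotal_order u s) as [Hlt|[->|Hgt]]; [apply Hbelow; lra|auto|].
    apply near_punctured, Hu; [lra|]; rewrite Rabs_pos_eq; lra. }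
  rewrite Hs in Ps; unfold P, ga in Ps.
  replace (z1 + RtoC 1 * (z0 - z1)) with z0 in Ps by ring; auto.
Qed.

(** Where a holomorphic extension across [z0] exists, [F z0] is its value; otherwise [z0] is a
    genuine pole, whose value is free. This is the way back from the weak class to the one of the
    definitions. *)
Lemma meromorphic_normalization (f : C -> C) :
  (forall z0, weakly_meromorphic_at f z0) ->
  exists F, meromorphic F /\
    (forall z0, punctured_near z0 (fun z => F z = f z)) /\
    (forall z0, holomorphic_at f z0 -> F z0 = f z0).
Proof.
intros Hf.
set (ext := fun z0 g => holomorphic_at g z0 /\ punctured_near z0 (fun z => f z = g z)).
destruct (choice (fun z0 l => forall g, ext z0 g -> l = g z0)) as [F HF].
{ intros z0; destruct (classic (exists g, ext z0 g)) as [[g [Hg Eg]]|Hno].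
  - exists (g z0); intros h [Hh Eh]; apply holomorphic_punctured_eq; auto.
    eapply punctured_mono; [|apply (punctured_and _ _ _ Eg Eh)].
    intros z [E1 E2]; congruence.
  - exists (RtoC 0); intros g Hg; exfalso; eauto. }
assert (Hhol : forall z0, holomorphic_at f z0 -> F z0 = f z0).
{ intros z0 H; apply HF; split; auto; exists 1%R; split; [lra|auto]. }
assert (Hpun : forall z0, punctured_near z0 (fun z => F z = f z)).
{ intros z0; eapply punctured_mono; [apply Hhol|].
  apply weakly_meromorphic_holomorphic_near, Hf. }
assert (Hrem : forall z0 g, ext z0 g -> holomorphic_at F z0).
{ intros z0 g Hg; apply holomorphic_ext with g; [|apply Hg].
  apply near_of_punctured; [symmetry; apply HF; auto|].
  eapply punctured_mono; [|apply (punctured_and _ _ _ (Hpun z0) (proj2 Hg))].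
  intros z [E1 E2]; congruence. }
exists F; split; [|split]; auto.
intros z0; destruct (weakly_meromorphic_order f z0 (Hf z0)) as [H|[m [k [h [Hh [H0 H]]]]]].
- left; apply Hrem with (fun _ => 0); split; [apply holomorphic_const|auto].
(* A numerator of order at least [m] makes the singularity removable; a smaller one leaves a pole of
   order [m - k]. *)
- destruct (le_lt_dec m k) as [Hmk|Hmk].
  + left; apply Hrem with (fun z => (z - z0) ^ (k - m) * h z); split.
    * apply holomorphic_mult; auto; apply holomorphic_pow, holomorphic_sub.
    * eapply punctured_mono; [|apply (punctured_and _ _ _ (punctured_neq z0) H)].
      intros z [Hz E]; rewrite E; replace k with (k - m + m)%nat at 1 by lia.
      rewrite Cpow_add_r; field; apply Cpow_nz, Cminus_neq_0; auto.
  + right; exists (m - k)%nat, h; split; [lia|split; [auto|split; auto]].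
    eapply punctured_mono; [|apply (punctured_and _ _ _ (punctured_neq z0)
      (punctured_and _ _ _ H (Hpun z0)))].
    intros z [Hz [E E']]; rewrite E', E; replace m with (m - k + k)%nat at 1 by lia.
    rewrite Cpow_add_r; field; split; apply Cpow_nz, Cminus_neq_0; auto.
Qed.

(** * Exponential and binomial series *)

Lemma Cexp_plus (z w : C) : Cexp (z + w) = Cexp z * Cexp w.
Proof.
destruct z as [a b], w as [c d]; unfold Cexp, Cmult; simpl.
rewrite exp_plus, cos_plus, sin_plus; apply injective_projections; simpl; ring.
Qed.

Lemma Cexp_0 : Cexp 0 = 1.
Proof. unfold Cexp; simpl; rewrite exp_0, cos_0, sin_0; apply injective_projections; simpl; ring. Qed.

Lemma Cmod_Cexp (z : C) : Cmod (Cexp z) = exp (Re z).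
Proof.
unfold Cexp, Cmod; simpl.
replace (_ + _)%R with (exp (Re z) * exp (Re z) *
  (Rsqr (sin (Im z)) + Rsqr (cos (Im z))))%R by (unfold Rsqr; ring).
rewrite sin2_cos2, Rmult_1_r; apply sqrt_square, Rlt_le, exp_pos.
Qed.

Lemma Re_csum (u : nat -> C) (n : nat) : Re (csum u n) = sum_f_R0 (fun k => Re (u k)) n.
Proof. induction n as [|n IH]; simpl; [|rewrite <- IH]; reflexivity. Qed.

Lemma Im_csum (u : nat -> C) (n : nat) : Im (csum u n) = sum_f_R0 (fun k => Im (u k)) n.
Proof. induction n as [|n IH]; simpl; [|rewrite <- IH]; reflexivity. Qed.

Lemma Cmod_le_Re_Im (z : C) : (Cmod z <= Rabs (Re z) + Rabs (Im z))%R.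
Proof.
replace z with (RtoC (Re z) + Ci * RtoC (Im z)) at 1.
- eapply Rle_trans; [apply Cmod_triangle|].
  rewrite Cmod_mult, Cmod_Ci, !Cmod_R; lra.
- destruct z as [a b]; apply injective_projections; simpl; ring.
Qed.

Lemma is_cseries_Re_Im (u : nat -> C) (l : C) :
  is_series (fun k => Re (u k)) (Re l) -> is_series (fun k => Im (u k)) (Im l) ->
  is_cseries u l.
Proof.
intros H1 H2; apply is_series_Reals in H1; apply is_series_Reals in H2.
apply is_cseries_eps; intros eps He.
destruct (H1 (eps / 2)%R ltac:(lra)) as [N1 HN1].
destruct (H2 (eps / 2)%R ltac:(lra)) as [N2 HN2].
exists (max N1 N2); intros n Hn.
specialize (HN1 n ltac:(lia)); specialize (HN2 n ltac:(lia)); unfold R_dist in *.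
eapply Rle_lt_trans; [apply Cmod_le_Re_Im|].
rewrite <- Re_csum in HN1; rewrite <- Im_csum in HN2.
assert (E1 : Re (csum u n - l) = (Re (csum u n) - Re l)%R) by reflexivity.
assert (E2 : Im (csum u n - l) = (Im (csum u n) - Im l)%R) by reflexivity.
rewrite E1, E2; unfold Rdist in *; lra.
Qed.

Lemma CV_radius_gt (a : nat -> R) (rho M x : R) :
  (forall j, (Rabs (a j * rho ^ j) <= M)%R) -> (0 <= x < rho)%R ->
  Rbar_lt (Rabs x) (CV_radius a).
Proof.
intros H Hx; apply Rbar_lt_le_trans with (Finite rho).
- simpl; rewrite Rabs_pos_eq; lra.
- apply (proj1 (CV_radius_bounded a)); exists M; auto.
Qed.

(** Half of a complex differential equation in real form: real and imaginary parts are coupled,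
    hence the second series [b]. The recurrence is the comparison of the coefficients of [x ^ j]. *)
Lemma PSeries_ode (a b : nat -> R) (p s q x : R) :
  Rbar_lt (Rabs x) (CV_radius a) -> Rbar_lt (Rabs x) (CV_radius b) ->
  (forall j, (INR (S j) * a (S j) = (p + q * INR j) * a j + s * b j)%R) ->
  ((1 - q * x) * PSeries (PS_derive a) x = p * PSeries a x + s * PSeries b x)%R.
Proof.
intros Ha Hb Hab.
assert (Hd : Rbar_lt (Rabs x) (CV_radius (PS_derive a))) by (rewrite CV_radius_derive; auto).
apply CV_radius_inside, PSeries_correct, is_pseries_R in Ha.
apply CV_radius_inside, PSeries_correct, is_pseries_R in Hb.
apply CV_radius_inside, PSeries_correct in Hd.
assert (Hi := is_pseries_incr_1 _ _ _ Hd).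
apply is_pseries_R in Hd; apply is_pseries_R in Hi.
set (A' := PSeries (PS_derive a) x) in *.
change (scal x A') with (x * A')%R in Hi.
assert (S1 := is_series_minus _ _ _ _ Hd (is_series_scal q _ _ Hi)).
assert (S2 := is_series_plus _ _ _ _ (is_series_scal p _ _ Ha) (is_series_scal s _ _ Hb)).
apply is_series_unique in S1; apply is_series_unique in S2.
transitivity (A' - q * (x * A'))%R; [ring|].
refine (eq_trans (eq_sym S1) (eq_trans _ S2)); apply Series_ext; intros [|n].
- unfold PS_derive, PS_incr_1, plus, opp, scal, zero; simpl; unfold mult; simpl.
  specialize (Hab 0%nat); simpl in Hab; lra.
- specialize (Hab (S n)); unfold PS_derive, PS_incr_1, plus, opp, scal.
  change ((INR (S (S n)) * a (S (S n)) * x ^ S n +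
    - (q * (INR (S n) * a (S n) * x ^ S n)) =
    p * (a (S n) * x ^ S n) + s * (b (S n) * x ^ S n))%R).
  rewrite Hab; ring.
Qed.

(* The recurrence says that [g x = sum c_j x^j] satisfies [(1 - q x) g' = w g],
   so [g x * Cexp (- w * L x)] is constant.  The cases [q = 0] and [q = 1] are
   the exponential and the binomial series. *)
Lemma is_cseries_ode (c : nat -> C) (w : C) (q rho M x0 : R) (L : R -> R) :
  c 0%nat = 1 ->
  (forall j, RtoC (INR (S j)) * c (S j) = (w + RtoC (q * INR j)) * c j) ->
  (0 <= x0 < rho)%R -> (forall j, (Cmod (c j) * rho ^ j <= M)%R) ->
  (forall x, (0 <= x <= x0)%R -> (0 < 1 - q * x)%R /\ is_derive L x (/ (1 - q * x))%R) ->
  L 0%R = 0%R ->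
  is_cseries (fun j => c j * RtoC x0 ^ j) (Cexp (w * RtoC (L x0))).
Proof.
intros H0 Hc Hx0 HM HL HL0.
destruct w as [p s].
set (a := fun j => Re (c j)); set (b := fun j => Im (c j)).
assert (Hrho : (0 < rho)%R) by lra.
assert (Ha : forall x, (0 <= x <= x0)%R -> Rbar_lt (Rabs x) (CV_radius a)).
{ intros x Hx; apply CV_radius_gt with rho M; [|lra].
  intros j; rewrite Rabs_mult, (Rabs_pos_eq (rho ^ j)) by (apply pow_le; lra).
  eapply Rle_trans; [|apply (HM j)]; apply Rmult_le_compat_r; [apply pow_le; lra|].
  apply re_le_Cmod. }
assert (Hb : forall x, (0 <= x <= x0)%R -> Rbar_lt (Rabs x) (CV_radius b)).
{ intros x Hx; apply CV_radius_gt with rho M; [|lra].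
  intros j; rewrite Rabs_mult, (Rabs_pos_eq (rho ^ j)) by (apply pow_le; lra).
  eapply Rle_trans; [|apply (HM j)]; apply Rmult_le_compat_r; [apply pow_le; lra|].
  eapply Rle_trans; [apply Rmax_r|apply Rmax_Cmod]. }
assert (Hrec : forall j, (INR (S j) * a (S j) = (p + q * INR j) * a j + (- s) * b j)%R /\
  (INR (S j) * b (S j) = (p + q * INR j) * b j + s * a j)%R).
{ intros j; specialize (Hc j); unfold a, b; destruct (c (S j)) as [a1 b1];
    destruct (c j) as [a2 b2]; unfold Cmult, Cplus, RtoC in Hc; cbn -[INR] in Hc.
  assert (E1 := f_equal fst Hc); assert (E2 := f_equal snd Hc); cbn -[INR] in *; lra. }
set (A := PSeries a); set (B := PSeries b).
set (A' := PSeries (PS_derive a)); set (B' := PSeries (PS_derive b)).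
assert (EA : forall x, (0 <= x <= x0)%R -> ((1 - q * x) * A' x = p * A x + (- s) * B x)%R).
{ intros x Hx; apply PSeries_ode; auto; intros j; apply Hrec. }
assert (EB : forall x, (0 <= x <= x0)%R -> ((1 - q * x) * B' x = p * B x + s * A x)%R).
{ intros x Hx; apply PSeries_ode; auto; intros j; apply Hrec. }
assert (DA : forall x, (0 <= x <= x0)%R -> is_derive A x (A' x))
  by (intros x Hx; apply is_derive_PSeries; auto).
assert (DB : forall x, (0 <= x <= x0)%R -> is_derive B x (B' x))
  by (intros x Hx; apply is_derive_PSeries; auto).
assert (A0 : A 0%R = 1%R) by (unfold A; rewrite PSeries_0; unfold a; rewrite H0; reflexivity).
assert (B0 : B 0%R = 0%R) by (unfold B; rewrite PSeries_0; unfold b; rewrite H0; reflexivity).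
(* [U] and [V] are the real and imaginary parts of [(A + i B) Cexp (- w L)], where [w = p + i s]. *)
set (U := fun x => (exp (- (p * L x)) * (cos (s * L x) * A x + sin (s * L x) * B x))%R).
set (V := fun x => (exp (- (p * L x)) * (cos (s * L x) * B x - sin (s * L x) * A x))%R).
assert (DU : forall x, (0 <= x <= x0)%R -> is_derive U x 0%R).
{ intros x Hx; destruct (HL x Hx) as [Hq HLx].
  assert (exL : ex_derive L x) by (eexists; eauto).
  assert (exA : ex_derive A x) by (eexists; auto).
  assert (exB : ex_derive B x) by (eexists; auto).
  unfold U; auto_derive; [repeat split; auto|].
  rewrite !(is_derive_unique (fun t : R => L t : R) _ _ HLx), !(is_derive_unique (fun t : R => A t : R) _ _ (DA x Hx)),
    !(is_derive_unique (fun t : R => B t : R) _ _ (DB x Hx)).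
  specialize (EA x Hx); specialize (EB x Hx).
  replace (A' x) with ((p * A x + - s * B x) / (1 - q * x))%R by (rewrite <- EA; field; lra).
  replace (B' x) with ((p * B x + s * A x) / (1 - q * x))%R by (rewrite <- EB; field; lra).
  field; lra. }
assert (DV : forall x, (0 <= x <= x0)%R -> is_derive V x 0%R).
{ intros x Hx; destruct (HL x Hx) as [Hq HLx].
  assert (exL : ex_derive L x) by (eexists; eauto).
  assert (exA : ex_derive A x) by (eexists; auto).
  assert (exB : ex_derive B x) by (eexists; auto).
  unfold V; auto_derive; [repeat split; auto|].
  rewrite !(is_derive_unique (fun t : R => L t : R) _ _ HLx), !(is_derive_unique (fun t : R => A t : R) _ _ (DA x Hx)),
    !(is_derive_unique (fun t : R => B t : R) _ _ (DB x Hx)).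
  specialize (EA x Hx); specialize (EB x Hx).
  replace (A' x) with ((p * A x + - s * B x) / (1 - q * x))%R by (rewrite <- EA; field; lra).
  replace (B' x) with ((p * B x + s * A x) / (1 - q * x))%R by (rewrite <- EB; field; lra).
  field; lra. }
assert (U0 : U x0 = 1%R /\ V x0 = 0%R).
{ assert (E : U 0%R = 1%R /\ V 0%R = 0%R).
  { unfold U, V; rewrite HL0, A0, B0, !Rmult_0_r, Ropp_0, exp_0, cos_0, sin_0; lra. }
  destruct (Req_dec x0 0) as [->|Hne]; auto.
  split; [rewrite <- (proj1 E)|rewrite <- (proj2 E)]; symmetry;
    apply (eq_is_derive (V := R_NormedModule)); auto; lra. }
unfold U, V in U0; destruct U0 as [U1 V1].
set (l := L x0) in *.
assert (He : (exp (p * l) * exp (- (p * l)) = 1)%R).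
{ rewrite <- exp_plus, Rplus_opp_r; apply exp_0. }
assert (Hsc := sin2_cos2 (s * l)); unfold Rsqr in Hsc.
(* Undo the rotation and the scaling at [x0], using that [U] is 1 and [V] is 0 there. *)
assert (FA : A x0 = (exp (p * l) * cos (s * l))%R).
{ set (C0 := cos (s * l)) in *; set (S0 := sin (s * l)) in *; set (E0 := exp (p * l)) in *;
    set (E1 := exp (- (p * l))) in *.
  transitivity ((E0 * E1) * (S0 * S0 + C0 * C0) * A x0)%R; [rewrite He, Hsc; ring|].
  transitivity (E0 * (C0 * (E1 * (C0 * A x0 + S0 * B x0)) -
    S0 * (E1 * (C0 * B x0 - S0 * A x0))))%R; [ring|].
  rewrite U1, V1; ring. }
assert (FB : B x0 = (exp (p * l) * sin (s * l))%R).
{ set (C0 := cos (s * l)) in *; set (S0 := sin (s * l)) in *; set (E0 := exp (p * l)) in *;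
    set (E1 := exp (- (p * l))) in *.
  transitivity ((E0 * E1) * (S0 * S0 + C0 * C0) * B x0)%R; [rewrite He, Hsc; ring|].
  transitivity (E0 * (S0 * (E1 * (C0 * A x0 + S0 * B x0)) +
    C0 * (E1 * (C0 * B x0 - S0 * A x0))))%R; [ring|].
  rewrite U1, V1; ring. }
assert (ER : Re (Cexp ((p, s) * RtoC l)) = A x0).
{ rewrite FA; unfold Cexp; cbn [Re fst]; rewrite re_scal_r, im_scal_r; reflexivity. }
assert (EI : Im (Cexp ((p, s) * RtoC l)) = B x0).
{ rewrite FB; unfold Cexp; cbn [Im snd]; rewrite re_scal_r, im_scal_r; reflexivity. }
apply is_cseries_Re_Im.
- rewrite ER; apply is_series_ext with (fun j => a j * x0 ^ j)%R.
  + intros j; rewrite <- RtoC_pow, re_scal_r; reflexivity.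
  + apply is_pseries_R, PSeries_correct, CV_radius_inside, Ha; lra.
- rewrite EI; apply is_series_ext with (fun j => b j * x0 ^ j)%R.
  + intros j; rewrite <- RtoC_pow, im_scal_r; reflexivity.
  + apply is_pseries_R, PSeries_correct, CV_radius_inside, Hb; lra.
Qed.

Lemma Cmod_exp_coef (w : C) (j : nat) :
  Cmod (w ^ j / RtoC (INR (fact j))) = (Cmod w ^ j / INR (fact j))%R.
Proof.
assert (Hf := INR_fact_neq_0 j).
rewrite Cmod_div, Cmod_pow, Cmod_R, Rabs_pos_eq; auto.
- apply pos_INR.
- intros E; apply RtoC_inj in E; auto.
Qed.

Lemma RtoC_INR_neq_0 (n : nat) : n <> 0%nat -> RtoC (INR n) <> 0.
Proof. intros H E; apply RtoC_inj in E; revert E; apply not_0_INR; auto. Qed.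

Lemma is_cseries_Cexp (w : C) :
  is_cseries (fun j => w ^ j / RtoC (INR (fact j))) (Cexp w).
Proof.
(* The radius 2 only has to exceed the point 1; each term there is below the full exponential series
   at [2 |w|]. *)
assert (H := is_cseries_ode (fun j => w ^ j / RtoC (INR (fact j))) w 0 2
  (exp (Cmod w * 2)) 1 (fun x => x)).
cbv beta in H; replace (w * RtoC 1) with w in H by ring.
eapply is_cseries_ext; [|apply H]; clear H.
- intros k; simpl; rewrite Cpow_1_l; ring.
- simpl; field; apply C1_nz.
- intros j; rewrite fact_simpl, mult_INR, RtoC_mult, Rmult_0_l; simpl Cpow.
  assert (T1 := RtoC_INR_neq_0 (S j) ltac:(lia)).
  assert (T2 := RtoC_INR_neq_0 (fact j) (fact_neq_0 j)).
  field; auto.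
- lra.
- intros j; rewrite Cmod_exp_coef.
  replace (Cmod w ^ j / INR (fact j) * 2 ^ j)%R
    with ((Cmod w * 2) ^ j / INR (fact j))%R
    by (rewrite Rpow_mult_distr; field; apply INR_fact_neq_0).
  assert (Hw : (0 <= Cmod w * 2)%R) by (assert (T := Cmod_ge_0 w); lra).
  eapply Rle_trans; [|apply (exp_ge_taylor _ j Hw)].
  apply (term_le_sum (fun k => (Cmod w * 2) ^ k / INR (fact k))%R); auto.
  intros k; apply Rdiv_le_0_compat; [apply pow_le; auto|apply INR_fact_lt_0].
- intros x Hx; split; [lra|].
  replace (/ (1 - 0 * x))%R with 1%R by field.
  apply (is_derive_id (K := R_AbsRing)).
- reflexivity.
Qed.

(** Expanding at [z0] leaves [Re (c * z0)] in the exponent, not the modulus of [c * z0]; the decay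
    of [m ^ (- s)] in Re s depends on this. *)
Lemma majorized_Cexp (c z0 : C) (r : R) :
  (0 <= r)%R ->
  majorized (fun z => Cexp (c * z)) z0 r (exp (Re (c * z0) + Cmod c * r)).
Proof.
intros Hr; exists (fun j => Cexp (c * z0) * (c ^ j / RtoC (INR (fact j)))); split.
- intros n; rewrite exp_plus, <- Cmod_Cexp.
  rewrite (sum_eq _ (fun j => Cmod (Cexp (c * z0)) * ((Cmod c * r) ^ j / INR (fact j)))%R).
  + rewrite sum_scal; apply Rmult_le_compat_l; [apply Cmod_ge_0|].
    apply exp_ge_taylor, Rmult_le_pos; auto; apply Cmod_ge_0.
  + intros j _; rewrite Cmod_mult, Cmod_exp_coef, Rpow_mult_distr.
    field; apply INR_fact_neq_0.
- intros z _; replace (Cexp (c * z)) with (Cexp (c * z0) * Cexp (c * (z - z0))).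
  + eapply is_cseries_ext, is_cseries_scal, is_cseries_Cexp.
    intros j; simpl; rewrite Cpow_mult_l; unfold Cdiv; ring.
  + rewrite <- Cexp_plus; f_equal; ring.
Qed.

(** * Complex powers of positive reals and sums of them *)

Lemma cpow_plus (x : R) (s t : C) : cpow x (s + t) = cpow x s * cpow x t.
Proof. unfold cpow; rewrite <- Cexp_plus; f_equal; ring. Qed.

Lemma cpow_0 (x : R) : cpow x 0 = 1.
Proof. unfold cpow; rewrite Cmult_0_l; apply Cexp_0. Qed.

Lemma cpow_1_l (s : C) : cpow 1 s = 1.
Proof. unfold cpow; rewrite ln_1, Cmult_0_r; apply Cexp_0. Qed.

Lemma cpow_1_r (x : R) : (0 < x)%R -> cpow x 1 = RtoC x.
Proof.
intros Hx; unfold cpow; rewrite Cmult_1_l; unfold Cexp; simpl.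
rewrite exp_ln, cos_0, sin_0 by auto; apply injective_projections; simpl; ring.
Qed.

Lemma cpow_INR (x : R) (n : nat) : (0 < x)%R -> cpow x (RtoC (INR n)) = RtoC x ^ n.
Proof.
intros Hx; induction n as [|n IH]; [apply cpow_0|].
rewrite S_INR, RtoC_plus, cpow_plus, IH, cpow_1_r by auto; simpl; ring.
Qed.

Lemma cpow_mult_l (x y : R) (s : C) :
  (0 < x)%R -> (0 < y)%R -> cpow (x * y) s = cpow x s * cpow y s.
Proof.
intros Hx Hy; unfold cpow; rewrite ln_mult, RtoC_plus, <- Cexp_plus by auto.
f_equal; ring.
Qed.

Lemma Cmod_cpow (x : R) (s : C) : Cmod (cpow x s) = Rpower x (Re s).
Proof. unfold cpow; rewrite Cmod_Cexp, re_scal_r; reflexivity. Qed.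

Lemma cpow_neq_0 (x : R) (s : C) : cpow x s <> 0.
Proof. apply Cmod_gt_0; rewrite Cmod_cpow; apply exp_pos. Qed.

Lemma ln_nonneg (x : R) : (1 <= x)%R -> (0 <= ln x)%R.
Proof. intros H; rewrite <- ln_1; apply ln_le; lra. Qed.

(** For [x >= 1] the bound is the supremum of the modulus over the disc, so passing to the weighted
    l1 norm costs nothing in the abscissa of convergence. *)
Lemma majorized_cpow (x : R) (z0 : C) (r : R) :
  (1 <= x)%R -> (0 <= r)%R ->
  majorized (fun s => cpow x (- s)) z0 r (Rpower x (- (Re z0 - r))).
Proof.
intros Hx Hr; assert (Hl := ln_nonneg x Hx).
apply majorized_ext with (fun s => Cexp (RtoC (- ln x) * s)).
- intros z _; unfold cpow; f_equal; rewrite RtoC_opp; ring.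
- eapply majorized_le; [|apply majorized_Cexp; auto].
  right; unfold Rpower; f_equal.
  rewrite re_scal_l, Cmod_R, Rabs_Ropp, Rabs_pos_eq by auto; ring.
Qed.

Lemma holomorphic_cpow (x : R) (z0 : C) : holomorphic_at (cpow x) z0.
Proof.
apply majorized_holomorphic with 1%R (exp (Re (RtoC (ln x) * z0) + Cmod (RtoC (ln x)) * 1));
  [lra|].
apply majorized_ext with (fun s => Cexp (RtoC (ln x) * s)).
- intros z _; unfold cpow; f_equal; ring.
- apply majorized_Cexp; lra.
Qed.

(** A discrete integral test, from [ln (1 - 1/x) <= - 1/x] and [exp t >= 1 + t]; the right-hand side
    telescopes. *)
Lemma Rpower_step (x d : R) :
  (1 < x)%R -> (0 < d)%R ->
  (d * Rpower x (- (d + 1)) <= Rpower (x - 1) (- d) - Rpower x (- d))%R.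
Proof.
intros Hx Hd.
assert (Hi : (0 < / x)%R) by (apply Rinv_0_lt_compat; lra).
assert (Hln : (ln (x - 1) <= ln x - / x)%R).
{ apply Rle_trans with (ln (x * exp (- / x)))%R.
  - apply ln_le; [lra|]; assert (T := exp_ineq1_le (- / x)).
    apply Rmult_le_compat_l with (r := x) in T; [|lra].
    replace (x * (1 + - / x))%R with (x - 1)%R in T by (field; lra); lra.
  - rewrite ln_mult, ln_exp; [lra|lra|apply exp_pos]. }
assert (H1 : (Rpower x (- (d + 1)) = Rpower x (- d) * / x)%R).
{ replace (- (d + 1))%R with (- d + - (1))%R by ring.
  rewrite Rpower_plus, (Rpower_Ropp x 1), Rpower_1 by lra; auto. }
assert (H2 : (Rpower x (- d) * (1 + d * / x) <= Rpower (x - 1) (- d))%R).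
{ apply Rle_trans with (Rpower x (- d) * exp (d * / x))%R.
  - apply Rmult_le_compat_l; [apply Rlt_le, exp_pos|apply exp_ineq1_le].
  - unfold Rpower; rewrite <- exp_plus; apply Rnot_lt_le; intros H.
    apply exp_lt_inv in H; apply Rmult_le_compat_l with (r := d) in Hln; lra. }
rewrite H1; lra.
Qed.

Lemma INR_SS (n : nat) : (2 <= INR (S (S n)))%R.
Proof. rewrite !S_INR; assert (H := pos_INR n); lra. Qed.

Lemma sum_Rpower_le (d : R) (n : nat) :
  (0 < d)%R ->
  (sum_f_R0 (fun k => Rpower (INR (S (S k))) (- (d + 1))) n <= / d)%R.
Proof.
intros Hd.
assert (H : (d * sum_f_R0 (fun k => Rpower (INR (S (S k))) (- (d + 1))) n <=
  1 - Rpower (INR (S (S n))) (- d))%R).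
{ induction n as [|n IH].
  - simpl sum_f_R0; eapply Rle_trans; [apply (Rpower_step (INR 2)); [simpl; lra|auto]|].
    replace (INR 2 - 1)%R with 1%R by (simpl; ring).
    replace (Rpower 1 (- d)) with 1%R; [lra|].
    unfold Rpower; rewrite ln_1, Rmult_0_r, exp_0; auto.
  - rewrite tech5, Rmult_plus_distr_l.
    assert (T := Rpower_step (INR (S (S (S n)))) d).
    replace (INR (S (S (S n))) - 1)%R with (INR (S (S n))) in T
      by (rewrite (S_INR (S (S n))); ring).
    assert (T2 := INR_SS n); rewrite (S_INR (S (S n))) in T at 1.
    specialize (T ltac:(lra) Hd); lra. }
assert (Hp : (0 < Rpower (INR (S (S n))) (- d))%R) by apply exp_pos.
apply Rmult_le_reg_l with d; auto; rewrite Rinv_r by lra; lra.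
Qed.

(** Each base is at least 2, so [i] extra units in the exponent gain a factor [(/ 2) ^ i]. *)
Lemma sum_Rpower_shift_le (d : R) (i n : nat) :
  (0 < d)%R ->
  (sum_f_R0 (fun k => Rpower (INR (S (S k))) (- (d + 1 + INR i))) n <=
    (/ 2) ^ i / d)%R.
Proof.
intros Hd; apply Rle_trans with
  (sum_f_R0 (fun k => (/ 2) ^ i * Rpower (INR (S (S k))) (- (d + 1)))%R n).
- apply sum_f_R0_le; intros k; assert (T := INR_SS k).
  replace (- (d + 1 + INR i))%R with (- INR i + - (d + 1))%R by ring.
  rewrite Rpower_plus; apply Rmult_le_compat_r; [apply Rlt_le, exp_pos|].
  rewrite Rpower_Ropp, Rpower_pow by lra; rewrite pow_inv.
  apply Rinv_le_contravar; [apply pow_lt; lra|apply pow_incr; lra].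
- rewrite sum_scal; apply Rmult_le_compat_l; [apply pow_le; lra|].
  apply sum_Rpower_le; auto.
Qed.

(** Keeping the discs inside [D] keeps them where [F] is the sum of the series; elsewhere choice
    leaves [F] unconstrained. *)
Lemma normal_series_holomorphic (D : C -> Prop) (f : nat -> C -> C) :
  (forall z0, D z0 -> exists r M Mk, (0 < r)%R /\
     (forall z, (Cmod (z - z0) <= r)%R -> D z) /\
     (forall k, majorized (f k) z0 r (Mk k)) /\
     (forall n, (sum_f_R0 Mk n <= M)%R)) ->
  exists F, forall z, D z -> is_cseries (fun k => f k z) (F z) /\ holomorphic_at F z.
Proof.
intros H.
destruct (choice (fun z l => D z -> is_cseries (fun k => f k z) l)) as [F HF].
{ intros z; destruct (classic (D z)) as [Hz|Hz].
  - destruct (H z Hz) as [r [M [Mk [Hr [_ [Hk HM]]]]]].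
    destruct (is_cseries_bounded (fun k => f k z) M) as [l [Hl _]].
    + intros n; eapply Rle_trans; [|apply (HM n)].
      apply sum_f_R0_le; intros k; eapply majorized_at; [apply Hk|].
      rewrite Cmod_minus_diag; lra.
    + exists l; auto.
  - exists (RtoC 0); tauto. }
exists F; intros z Hz; split; auto.
destruct (H z Hz) as [r [M [Mk [Hr [HD [Hk HM]]]]]].
apply majorized_holomorphic with r M; auto.
apply majorized_series with f Mk; auto.
Qed.

Lemma Re_ball (z z0 : C) (r : R) :
  (Cmod (z - z0) <= r)%R -> (Re z0 - r <= Re z <= Re z0 + r)%R.
Proof.
intros H; assert (T := re_le_Cmod (z - z0)).
replace (Re (z - z0)) with (Re z - Re z0)%R in T by reflexivity.
assert (T' : (Rabs (Re z - Re z0) <= r)%R) by lra.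
apply Rabs_le_between in T'; lra.
Qed.

(* The sum starts at n = 2, which makes it decay geometrically in Re s. *)
Definition is_zeta_minus_1 (F : C -> C) : Prop :=
  forall s, (1 < Re s)%R -> is_cseries (fun k => cpow (INR (S (S k))) (- s)) (F s).

Lemma zeta_minus_1_majorized (F : C -> C) (z0 : C) (r d : R) (i : nat) :
  is_zeta_minus_1 F -> (0 < r)%R -> (0 < d)%R -> (d + 1 + INR i <= Re z0 - r)%R ->
  majorized F z0 r ((/ 2) ^ i / d).
Proof.
intros HF Hr Hd Hz.
apply majorized_series with (f := fun k s => cpow (INR (S (S k))) (- s))
  (Mk := fun k => Rpower (INR (S (S k))) (- (d + 1 + INR i))); auto.
- intros k; assert (T := INR_SS k).
  eapply majorized_le; [|apply majorized_cpow; lra].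
  apply Rle_Rpower; lra.
- intros n; apply sum_Rpower_shift_le; auto.
- intros z Hz'; apply HF; apply Re_ball in Hz'; assert (T := pos_INR i); lra.
Qed.

Lemma zeta_minus_1_exists :
  exists F, is_zeta_minus_1 F /\ forall s, (1 < Re s)%R -> holomorphic_at F s.
Proof.
destruct (normal_series_holomorphic (fun s => (1 < Re s)%R)
  (fun k s => cpow (INR (S (S k))) (- s))) as [F HF].
(* Half the distance to the line Re = 1 serves both as radius and as margin: [Re z0 - d = 1 + d]. *)
- intros z0 Hz0; set (d := ((Re z0 - 1) / 2)%R).
  exists d, (/ d)%R, (fun k => Rpower (INR (S (S k))) (- (d + 1))).
  assert (Hd : (0 < d)%R) by (unfold d; lra).
  split; [auto|split; [|split]].
  + intros z Hz; apply Re_ball in Hz; unfold d in *; lra.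
  + intros k; assert (T := INR_SS k).
    eapply majorized_le; [|apply majorized_cpow; lra].
    apply Rle_Rpower; unfold d; lra.
  + intros n; apply sum_Rpower_le; auto.
- exists F; split; [intros s Hs|intros s Hs]; apply HF; auto.
Qed.

(* The coefficient of x^j in (1 - x)^(-w). *)
Fixpoint binom_coef (w : C) (j : nat) : C :=
  match j with
  | O => 1
  | S i => binom_coef w i * (w + RtoC (INR i)) / RtoC (INR (S i))
  end.

(** The coefficients of [(1 - x) ^ (- A)], which dominate those for every [w] of modulus at most
    [A]. *)
Fixpoint binom_bound (A : R) (j : nat) : R :=
  match j with
  | O => 1%R
  | S i => (binom_bound A i * (A + INR i) / INR (S i))%R
  end.

Lemma binom_bound_nonneg (A : R) (j : nat) : (0 <= A)%R -> (0 <= binom_bound A j)%R.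
Proof.
intros HA; induction j as [|j IH]; cbn -[INR]; [lra|].
apply Rdiv_le_0_compat; [|apply lt_0_INR; lia].
apply Rmult_le_pos; auto; assert (T := pos_INR j); lra.
Qed.

(** The ratio of consecutive terms is [(A + j) / (j + 1)], at most 3/2 once [j >= 2 A]. Any base
    strictly between 1 and 2 would do: its product with 1/2 must stay below 1. *)
Lemma binom_bound_le (A : R) :
  (0 <= A)%R -> exists K, (0 <= K)%R /\ forall j, (binom_bound A j <= K * (3 / 2) ^ j)%R.
Proof.
intros HA; destruct (INR_unbounded (2 * A)) as [m Hm].
set (v := fun j => (binom_bound A j / (3 / 2) ^ j)%R).
assert (Hp : forall j, (0 < (3 / 2) ^ j)%R) by (intros j; apply pow_lt; lra).
assert (Hv : forall j, (0 <= v j)%R).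
{ intros j; apply Rdiv_le_0_compat; auto; apply binom_bound_nonneg; auto. }
exists (sum_f_R0 v m); split; [apply cond_pos_sum; auto|].
assert (Hle : forall j, (v j <= sum_f_R0 v m)%R).
{ intros j; destruct (le_lt_dec j m) as [Hj|Hj]; [apply term_le_sum; auto|].
  assert (Hdec : forall k, (v (m + k)%nat <= v m)%R).
  { induction k as [|k IH]; [rewrite Nat.add_0_r; lra|].
    eapply Rle_trans; [|apply IH]; rewrite Nat.add_succ_r; unfold v; cbn -[INR].
    assert (HS : (0 < INR (S (m + k)))%R) by (apply lt_0_INR; lia).
    assert (Hb := binom_bound_nonneg A (m + k) HA).
    specialize (Hp (m + k)%nat); set (p := ((3 / 2) ^ (m + k))%R) in *.
    replace (binom_bound A (m + k) * (A + INR (m + k)) / INR (S (m + k)) / (3 / 2 * p))%R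
      with (binom_bound A (m + k) / p * ((A + INR (m + k)) / (3 / 2 * INR (S (m + k)))))%R
      by (field; lra).
    rewrite <- (Rmult_1_r (binom_bound A (m + k) / p)) at 2.
    apply Rmult_le_compat_l; [apply Rdiv_le_0_compat; auto|].
    apply Rmult_le_reg_r with (3 / 2 * INR (S (m + k)))%R; [lra|].
    unfold Rdiv at 1; rewrite Rmult_assoc, Rinv_l, Rmult_1_r, Rmult_1_l by lra.
    rewrite S_INR, plus_INR; assert (T := pos_INR k); lra. }
  replace j with (m + (j - m))%nat by lia.
  eapply Rle_trans; [apply Hdec|apply term_le_sum; auto]. }
intros j; specialize (Hle j); specialize (Hp j).
apply Rmult_le_compat_r with (r := ((3 / 2) ^ j)%R) in Hle; [|lra].
unfold v in Hle at 1; unfold Rdiv at 1 in Hle; rewrite Rmult_assoc, Rinv_l in Hle; lra.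
Qed.

Lemma majorized_binom_coef (z0 p : C) (r A : R) (j : nat) :
  (0 < r)%R -> (Cmod (z0 - p) + r <= A)%R ->
  majorized (fun s => binom_coef (s - p) j) z0 r (binom_bound A j).
Proof.
intros Hr HA; induction j as [|j IH].
- simpl; generalize (majorized_const 1 z0 r); rewrite Cmod_1; auto.
- apply majorized_ext with (fun s => / RtoC (INR (S j)) *
    (binom_coef (s - p) j * (s - (p - RtoC (INR j))))).
  + intros z _; cbn -[INR]; unfold Cdiv; ring.
  + assert (Hj : (0 < INR (S j))%R) by (apply lt_0_INR; lia).
    replace (binom_bound A (S j)) with
      (Cmod (/ RtoC (INR (S j))) * (binom_bound A j * (A + INR j)))%R.
    * apply majorized_scal, majorized_mult; auto.
      eapply majorized_le; [|apply majorized_sub; lra].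
      replace (z0 - (p - RtoC (INR j))) with ((z0 - p) + RtoC (INR j)) by ring.
      assert (T := Cmod_triangle (z0 - p) (RtoC (INR j))).
      rewrite Cmod_R, Rabs_pos_eq in T by apply pos_INR; lra.
    * rewrite Cmod_inv, Cmod_R, Rabs_pos_eq by (try apply RtoC_INR_neq_0; try lia; lra).
      cbn -[INR]; unfold Rdiv; ring.
Qed.

Lemma Cmod_binom_coef (w : C) (j : nat) :
  (Cmod (binom_coef w j) <= binom_bound (Cmod w) j)%R.
Proof.
induction j as [|j IH]; cbn -[INR]; [rewrite Cmod_1; lra|].
assert (Hj : (0 < INR (S j))%R) by (apply lt_0_INR; lia).
rewrite Cmod_div, Cmod_mult, Cmod_R, Rabs_pos_eq by (try apply RtoC_INR_neq_0; try lia; lra).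
apply Rmult_le_compat_r; [apply Rlt_le, Rinv_0_lt_compat; auto|].
apply Rmult_le_compat; auto; try apply Cmod_ge_0.
eapply Rle_trans; [apply Cmod_triangle|]; rewrite Cmod_R, Rabs_pos_eq by apply pos_INR; lra.
Qed.

Lemma is_cseries_binomial (w : C) (x : R) :
  (0 <= x <= / 2)%R ->
  is_cseries (fun j => binom_coef w j * RtoC x ^ j) (Cexp (w * RtoC (- ln (1 - x)))).
Proof.
intros Hx; destruct (binom_bound_le (Cmod w) (Cmod_ge_0 w)) as [K [HK Hb]].
(* 2/3 is the inverse of the growth rate 3/2, so the terms stay below [K] there, and it exceeds
   1/2. *)
apply (is_cseries_ode (binom_coef w) w 1 (2 / 3) K x (fun x => (- ln (1 - x))%R)).
- reflexivity.
- intros j; cbn -[INR]; rewrite Rmult_1_l; field; apply RtoC_INR_neq_0; lia.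
- lra.
- intros j; eapply Rle_trans.
  + apply Rmult_le_compat_r; [apply pow_le; lra|].
    eapply Rle_trans; [apply Cmod_binom_coef|apply Hb].
  + rewrite Rmult_assoc, <- Rpow_mult_distr.
    replace (3 / 2 * (2 / 3))%R with 1%R by field; rewrite pow1; lra.
- intros y Hy; split; [lra|]; auto_derive; [lra|field; lra].
- rewrite Rminus_0_r, ln_1; ring.
Qed.

(** With [m = k + 2], write [m - 1 = m (1 - 1/m)] and expand at [1/m <= 1/2]. *)
Lemma is_cseries_cpow_pred (w : C) (k : nat) :
  is_cseries (fun j => binom_coef w j * cpow (INR (S (S k))) (- (w + RtoC (INR j))))
    (cpow (INR (S k)) (- w)).
Proof.
set (m := INR (S (S k))).
assert (Hm : (2 <= m)%R) by apply INR_SS.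
assert (Hx : (0 <= / m <= / 2)%R).
{ split; [apply Rlt_le, Rinv_0_lt_compat; lra|apply Rinv_le_contravar; lra]. }
assert (E : cpow (INR (S k)) (- w) = cpow m (- w) * Cexp (w * RtoC (- ln (1 - / m)))).
{ unfold cpow; rewrite <- Cexp_plus; f_equal.
  replace (INR (S k)) with (m * (1 - / m))%R.
  - rewrite ln_mult, RtoC_plus, RtoC_opp by lra; ring.
  - unfold m in *; rewrite (S_INR (S k)) in *; field; lra. }
rewrite E; eapply is_cseries_ext, is_cseries_scal, (is_cseries_binomial w (/ m) Hx).
intros j; simpl.
replace (- (w + RtoC (INR j))) with (- w + - RtoC (INR j)) by ring.
rewrite cpow_plus.
replace (cpow m (- RtoC (INR j))) with (RtoC (/ m) ^ j); [ring|].
assert (Hm0 : RtoC m <> 0) by (intros H; apply RtoC_inj in H; lra).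
rewrite RtoC_inv by lra; rewrite Cpow_inv by auto.
rewrite <- (cpow_INR m j) by lra; set (p := cpow m (RtoC (INR j))).
assert (Hp : p <> 0) by apply cpow_neq_0.
assert (E1 : cpow m (- RtoC (INR j)) * p = 1).
{ unfold p; rewrite <- cpow_plus, <- (cpow_0 m); f_equal; ring. }
rewrite <- (Cmult_1_l (/ p)), <- E1; field; auto.
Qed.

Lemma csum_telescope (u : nat -> C) (n : nat) :
  csum (fun k => u k - u (S k)) n = u 0%nat - u (S n).
Proof. induction n as [|n IH]; simpl; [|rewrite IH]; ring. Qed.

Lemma is_cseries_telescope_cpow (w : C) :
  (0 < Re w)%R ->
  is_cseries (fun k => cpow (INR (S k)) (- w) - cpow (INR (S (S k))) (- w)) (RtoC 1).
Proof.
intros Hw; apply is_cseries_eps; intros eps He.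
(* Above this bound the power with exponent [- Re w] is smaller than [eps]. *)
destruct (INR_unbounded (Rpower eps (- / Re w))) as [N HN].
exists N; intros n Hn.
rewrite (csum_telescope (fun k => cpow (INR (S k)) (- w))).
replace (INR 1) with 1%R by reflexivity; rewrite cpow_1_l.
replace (1 - cpow (INR (S (S n))) (- w) - 1) with (- cpow (INR (S (S n))) (- w)) by ring.
rewrite Cmod_opp, Cmod_cpow.
assert (Hlt : (Rpower eps (- / Re w) < INR (S (S n)))%R).
{ eapply Rlt_le_trans; [apply HN|apply le_INR; lia]. }
unfold Rpower in *.
assert (H2 := INR_SS n).
apply ln_increasing in Hlt; [|apply exp_pos]; rewrite ln_exp in Hlt.
rewrite <- (exp_ln eps) by auto; apply exp_increasing.
replace (Re (- w)) with (- Re w)%R by reflexivity.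
apply Rmult_lt_compat_l with (r := Re w) in Hlt; auto.
replace (Re w * (- / Re w * ln eps))%R with (- ln eps)%R in Hlt by (field; lra); lra.
Qed.

(* Expand each term of [sum_(m >= 2) ((m-1)^(-w) - m^(-w)) = 1] by the binomial
   series and exchange the summations. *)
Lemma is_cseries_binom_zeta (F : C -> C) (w : C) :
  is_zeta_minus_1 F -> (0 < Re w)%R ->
  is_cseries (fun j => binom_coef w (S j) * F (w + RtoC (INR (S j)))) (RtoC 1).
Proof.
intros HF Hw; destruct (binom_bound_le (Cmod w) (Cmod_ge_0 w)) as [K [HK Hb]].
assert (HRe : forall j, Re (w + RtoC (INR (S j))) = (Re w + 1 + INR j)%R).
{ intros j; change (Re (w + RtoC (INR (S j)))) with (Re w + INR (S j))%R.
  rewrite S_INR; ring. }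
apply cseries_fubini with
  (a := fun k j => binom_coef w (S j) * cpow (INR (S (S k))) (- (w + RtoC (INR (S j)))))
  (b := fun k => cpow (INR (S k)) (- w) - cpow (INR (S (S k))) (- w))
  (M := (6 * K / Re w)%R).
- intros m n; rewrite sum_switch.
  (* Growth [(3/2) ^ S j] against decay [(1/2) ^ j / Re w]; the geometric sum is at most 4, whence
     [6 K / Re w]. *)
  apply Rle_trans with (sum_f_R0 (fun j => (3 / 2 * K / Re w) * (3 / 4) ^ j)%R n).
  + apply sum_f_R0_le; intros j.
    rewrite (sum_eq _ (fun k => Cmod (binom_coef w (S j)) *
      Rpower (INR (S (S k))) (- (Re w + 1 + INR j)))%R).
    * rewrite sum_scal; eapply Rle_trans.
      -- apply Rmult_le_compat; [apply Cmod_ge_0| | |].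
         ++ apply cond_pos_sum; intros k; apply Rlt_le, exp_pos.
         ++ eapply Rle_trans; [apply Cmod_binom_coef|apply Hb].
         ++ apply sum_Rpower_shift_le; auto.
      -- right; replace ((3 / 4) ^ j)%R with ((3 / 2) ^ j * (/ 2) ^ j)%R.
         ++ simpl; field; lra.
         ++ rewrite <- Rpow_mult_distr; f_equal; field.
    * intros k _; rewrite Cmod_mult, Cmod_cpow.
      change (Re (- (w + RtoC (INR (S j))))) with (- Re (w + RtoC (INR (S j))))%R.
      rewrite HRe; auto.
  + rewrite sum_scal, tech3 by lra.
    assert (HS : (0 < (3 / 4) ^ S n)%R) by (apply pow_lt; lra).
    replace (6 * K / Re w)%R with (3 / 2 * K / Re w * 4)%R by (field; lra).
    apply Rmult_le_compat_l; [apply Rdiv_le_0_compat; lra|lra].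
(* The term [j = 0] of the binomial expansion is [m ^ (- w)] itself; removing it leaves the
   telescoping difference. *)
- intros k; assert (H := is_cseries_behead _ _ (is_cseries_cpow_pred w k)).
  cbv beta in H; change (binom_coef w 0) with (RtoC 1) in H; rewrite Cmult_1_l in H.
  replace (w + RtoC (INR 0)) with w in H by (simpl; ring); exact H.
- intros j; apply is_cseries_scal, HF; rewrite HRe; assert (T := pos_INR j); lra.
- apply is_cseries_telescope_cpow; auto.
Qed.

(** * Continuation of the zeta function *)

(** The arguments of [F] in this tail have real part [Re s + J + 1 + k], which exceeds 1 when
    [Re s > - J]: the Dirichlet series of [F] suffices. *)
Lemma zeta_tail_exists (F : C -> C) (J : nat) :
  is_zeta_minus_1 F ->
  exists T, forall s, (- INR J < Re s)%R ->
    is_cseries (fun k => binom_coef (s - 1) (S (S J + k)) *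
      F (s - 1 + RtoC (INR (S (S J + k))))) (T s) /\ holomorphic_at T s.
Proof.
intros HF; apply (normal_series_holomorphic (fun s => (- INR J < Re s)%R)).
intros z0 Hz0; set (d := ((Re z0 + INR J) / 2)%R).
assert (Hd : (0 < d)%R) by (unfold d; lra).
set (A := (Cmod (z0 - 1) + d)%R).
assert (HA : (0 <= A)%R) by (unfold A; assert (T := Cmod_ge_0 (z0 - 1)); lra).
destruct (binom_bound_le A HA) as [K [HK Hb]].
(* The coefficient is bounded by [K (3/2) ^ (J + 2 + k)] and [F] by [(1/2) ^ k / d]; the product is
   [B (3/4) ^ k]. *)
set (B := (K * (3 / 2) ^ S (S J) / d)%R).
assert (HB : (0 <= B)%R).
{ apply Rdiv_le_0_compat; auto; apply Rmult_le_pos; auto; apply pow_le; lra. }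
exists d, (4 * B)%R, (fun k => B * (3 / 4) ^ k)%R.
split; [auto|split; [|split]].
- intros z Hz; apply Re_ball in Hz; unfold d in *; lra.
- intros k; apply majorized_le with
    (binom_bound A (S (S J + k)) * ((/ 2) ^ k / d))%R.
  + eapply Rle_trans; [apply Rmult_le_compat_r; [|apply Hb]|].
    * apply Rdiv_le_0_compat; auto; apply pow_le; lra.
    * right; unfold B; change (S (S J + k)) with (S (S J) + k)%nat.
      replace ((3 / 4) ^ k)%R with ((3 / 2) ^ k * (/ 2) ^ k)%R
        by (rewrite <- Rpow_mult_distr; f_equal; field).
      rewrite pow_add; field; lra.
  + apply majorized_mult; auto; [apply majorized_binom_coef; auto; unfold A; lra|].
    set (be := RtoC (INR (S (S J + k))) - 1).
    apply majorized_ext with (fun z => F (1 * z + be)).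
    * intros z _; f_equal; unfold be; ring.
    * replace d with (d / Cmod 1)%R at 1 by (rewrite Cmod_1; field).
      apply majorized_affine; [apply C1_nz|].
      apply zeta_minus_1_majorized; auto.
      rewrite Cmult_1_l; change (Re (z0 + be)) with (Re z0 + (INR (S (S J + k)) + - (1)))%R.
      rewrite !S_INR, !plus_INR, S_INR; unfold d; lra.
- intros n; rewrite sum_scal, Rmult_comm; apply Rmult_le_compat_r; auto.
  assert (HS : (0 < (3 / 4) ^ S n)%R) by (apply pow_lt; lra).
  rewrite tech3 by lra; lra.
Qed.

Definition extends_zeta_minus_1 (Z0 : C -> C) (J : nat) (F : C -> C) : Prop :=
  (forall s, (1 < Re s)%R -> F s = Z0 s) /\
  (forall s, (1 - INR J < Re s)%R -> weakly_meromorphic_at F s).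

(** The recursion is solved for [(s - 1) Z(s)]. When [Re s > - J], the arguments [s + i] with
    [i >= 1] of the finitely many middle terms lie in the half-plane of the previous stage. *)
Lemma zeta_continuation (Z0 : C -> C) (J : nat) :
  is_zeta_minus_1 Z0 -> (forall s, (1 < Re s)%R -> holomorphic_at Z0 s) ->
  exists F, extends_zeta_minus_1 Z0 J F.
Proof.
intros HZ Hhol; induction J as [|J [F [HF1 HF2]]].
- exists Z0; split; auto; intros s Hs; apply holomorphic_weakly_meromorphic, Hhol.
  simpl in Hs; lra.
- destruct (zeta_tail_exists Z0 J HZ) as [T HT].
  set (u := fun s i => binom_coef (s - 1) (S i) * F (s - 1 + RtoC (INR (S i)))).
  (* Index 0 is blanked out: [u s 0] stands for [(s - 1) Z(s)], the term being solved for. *)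
  set (G := fun s => csum (fun i => match i with O => RtoC 0 | S _ => u s i end) J).
  exists (fun s => (1 + - (1) * G s + - (1) * T s) * / (s - 1)); split.
  + intros s Hs.
    assert (Hw : (0 < Re (s - 1))%R) by (change (Re (s - 1)) with (Re s - 1)%R; lra).
    assert (H := is_cseries_drop _ _ J (is_cseries_binom_zeta Z0 (s - 1) HZ Hw)).
    assert (HJ : (- INR J < Re s)%R) by (assert (T' := pos_INR J); lra).
    assert (E := is_cseries_unique _ _ _ H (proj1 (HT s HJ))).
    assert (Eu : forall i, binom_coef (s - 1) (S i) * Z0 (s - 1 + RtoC (INR (S i))) = u s i).
    { intros i; unfold u; rewrite HF1; auto.
      change (Re (s - 1 + RtoC (INR (S i)))) with (Re s - 1 + INR (S i))%R.
      rewrite S_INR; assert (T' := pos_INR i); lra. }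
    rewrite (csum_ext _ (u s)) in E by (intros; apply Eu).
    assert (EG : csum (u s) J = u s 0%nat + G s).
    { unfold G; clear; induction J as [|J IH]; simpl; [|rewrite IH]; ring. }
    rewrite EG in E.
    assert (E0 : u s 0%nat = (s - 1) * Z0 s).
    { rewrite <- Eu; simpl; f_equal; [field; apply C1_nz|f_equal; ring]. }
    assert (Hn : s - 1 <> 0).
    { intros Hn; rewrite Hn in Hw; simpl in Hw; lra. }
    rewrite <- E, E0; field; auto.
  + intros s Hs; rewrite S_INR in Hs.
    apply weakly_meromorphic_mult; [|apply weakly_meromorphic_inv_sub].
    repeat apply weakly_meromorphic_plus.
    * apply holomorphic_weakly_meromorphic, holomorphic_const.
    * apply weakly_meromorphic_mult;
        [apply holomorphic_weakly_meromorphic, holomorphic_const|].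
      apply (weakly_meromorphic_csum
        (fun i s => match i with O => RtoC 0 | S _ => u s i end)).
      intros [|i] Hi; [apply holomorphic_weakly_meromorphic, holomorphic_const|].
      apply weakly_meromorphic_mult.
      -- apply holomorphic_weakly_meromorphic.
         apply majorized_holomorphic with 1%R
           (binom_bound (Cmod (s - 1) + 1) (S (S i))); [lra|].
         apply majorized_binom_coef; lra.
      -- apply weakly_meromorphic_ext with
           (fun z => F (1 * z + (RtoC (INR (S (S i))) - 1))).
         { exists 1%R; split; [lra|]; intros z _ _; f_equal; ring. }
         apply weakly_meromorphic_affine; [apply C1_nz|]; apply HF2.
         rewrite Cmult_1_l.
         change (Re (s + (RtoC (INR (S (S i))) - 1))) with (Re s + (INR (S (S i)) + - (1)))%R.
         rewrite !S_INR; assert (T' := pos_INR i); lra.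
    * apply weakly_meromorphic_mult; apply holomorphic_weakly_meromorphic;
        [apply holomorphic_const|apply HT; lra].
Qed.

(** * Identity theorem on half-planes and gluing of the continuations *)

Lemma weakly_meromorphic_minus (f g : C -> C) (z0 : C) :
  weakly_meromorphic_at f z0 -> weakly_meromorphic_at g z0 ->
  weakly_meromorphic_at (fun z => f z - g z) z0.
Proof.
intros Hf Hg; apply weakly_meromorphic_ext with (fun z => f z + - (1) * g z).
- exists 1%R; split; [lra|]; intros; ring.
- apply weakly_meromorphic_plus, weakly_meromorphic_mult; auto.
  apply holomorphic_weakly_meromorphic, holomorphic_const.
Qed.

Lemma near_Re_gt (a : R) (s : C) : (a < Re s)%R -> near s (fun z => (a < Re z)%R).
Proof.
intros Hs; exists (Re s - a)%R; split; [lra|]; intros z Hz.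
assert (T := Re_ball z s (Cmod (z - s)) (Rle_refl _)); lra.
Qed.

(** Half-planes are convex: join [z0] to a real point [c] to the right of both abscissas, near which
    the functions agree. *)
Lemma half_plane_identity (f g : C -> C) (a b : R) (z0 : C) :
  (forall s, (a < Re s)%R -> weakly_meromorphic_at f s) ->
  (forall s, (a < Re s)%R -> weakly_meromorphic_at g s) ->
  (forall s, (b < Re s)%R -> f s = g s) ->
  (a < Re z0)%R -> punctured_near z0 (fun z => f z = g z).
Proof.
intros Hf Hg Hfg Hz0.
set (c := (Rmax a b + 1)%R).
assert (Hca : (a < c)%R) by (unfold c; assert (T := Rmax_l a b); lra).
assert (Hcb : (b < c)%R) by (unfold c; assert (T := Rmax_r a b); lra).
assert (H : punctured_near z0 (fun z => f z - g z = 0)).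
{ apply weakly_meromorphic_zero_segment with (RtoC c).
  - intros t Ht.
    assert (Hre : Re (RtoC c + RtoC t * (z0 - RtoC c)) = ((1 - t) * c + t * Re z0)%R).
    { change (Re (RtoC c + RtoC t * (z0 - RtoC c)))
        with (c + Re (RtoC t * (z0 - RtoC c)))%R.
      rewrite re_scal_l; change (Re (z0 - RtoC c)) with (Re z0 - c)%R; ring. }
    assert (a < Re (RtoC c + RtoC t * (z0 - RtoC c)))%R.
    { rewrite Hre; destruct (Req_dec t 0) as [->|Hne]; [lra|].
      assert (0 < t * (Re z0 - a))%R by (apply Rmult_lt_0_compat; lra).
      assert (0 <= (1 - t) * (c - a))%R by (apply Rmult_le_pos; lra).
      nra. }
    apply weakly_meromorphic_minus; auto.
  - apply near_punctured; eapply near_mono; [|apply (near_Re_gt b (RtoC c) Hcb)].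
    intros z Hz; rewrite Hfg by auto; ring. }
eapply punctured_mono; [|apply H]; intros z Hz; apply Ceq_minus; auto.
Qed.

(** The value at [s] is taken from a stage depending on [Re s]. Near a given point only finitely
    many stages occur, and the identity theorem makes them agree close to that point, off it. *)
Lemma zeta_minus_1_continuation (Z0 : C -> C) :
  is_zeta_minus_1 Z0 -> (forall s, (1 < Re s)%R -> holomorphic_at Z0 s) ->
  exists F, (forall s, (1 < Re s)%R -> F s = Z0 s) /\
    forall s, weakly_meromorphic_at F s.
Proof.
intros HZ Hhol.
destruct (choice _ (fun J => zeta_continuation Z0 J HZ Hhol)) as [F HF].
(* The 2 in place of 1 gives a unit of slack: for [z] within distance 1 of [z0], the stage [J z] is
   still meromorphic at [z0]. *)
set (J := fun s => Z.to_nat (up (2 - Re s))).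
assert (HJ : forall s, (2 - Re s < INR (J s))%R /\ (INR (J s) <= Rmax 0 (3 - Re s))%R).
{ intros s; unfold J; destruct (archimed (2 - Re s)) as [H1 H2].
  destruct (Z_le_gt_dec 0 (up (2 - Re s))) as [Hle|Hgt].
  - rewrite INR_IZR_INZ, Z2Nat.id by auto; split; [lra|].
    eapply Rle_trans; [|apply Rmax_r]; lra.
  - assert (H0 : (IZR (up (2 - Re s)) < 0)%R) by (apply IZR_lt; lia).
    replace (Z.to_nat (up (2 - Re s))) with 0%nat by lia; simpl; split; [lra|apply Rmax_l]. }
exists (fun s => F (J s) s); split; [intros s Hs; apply HF; auto|].
intros z0; set (J0 := J z0).
assert (Hall : forall N, punctured_near z0 (fun z =>
  forall j, (j <= N)%nat -> (1 - INR j < Re z0)%R -> F j z = F J0 z)).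
{ assert (Hone : forall j, punctured_near z0 (fun z =>
    (1 - INR j < Re z0)%R -> F j z = F J0 z)).
  { intros j; destruct (Rlt_dec (1 - INR j) (Re z0)) as [Hj|Hj].
    - assert (HJ0 := proj1 (HJ z0)); fold J0 in HJ0.
      eapply punctured_mono; [|apply (half_plane_identity (F j) (F J0)
        (Rmax (1 - INR j) (1 - INR J0)) 1 z0)]; auto.
      + intros s Hs; apply (proj2 (HF j)); eapply Rle_lt_trans; [apply Rmax_l|apply Hs].
      + intros s Hs; apply (proj2 (HF J0)); eapply Rle_lt_trans; [apply Rmax_r|apply Hs].
      + intros s Hs; rewrite (proj1 (HF j)), (proj1 (HF J0)); auto.
      + apply Rmax_lub_lt; lra.
    - exists 1%R; split; [lra|]; intros; contradiction. }
  induction N as [|N IH].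
  - eapply punctured_mono; [|apply (Hone 0%nat)].
    intros z Hz j Hj; replace j with 0%nat by lia; auto.
  - eapply punctured_mono; [|apply (punctured_and _ _ _ IH (Hone (S N)))].
    intros z [H1 H2] j Hj; destruct (le_lt_dec j N) as [Hle|Hgt]; [apply H1; auto|].
    replace j with (S N) by lia; auto. }
(* This number bounds all the stages used on the unit disc around [z0]. *)
destruct (INR_unbounded (4 + Rabs (Re z0))) as [N HN].
apply weakly_meromorphic_ext with (F J0).
- assert (H1 : punctured_near z0 (fun z => (Cmod (z - z0) < 1)%R)) by
    (exists 1%R; split; [lra|auto]).
  eapply punctured_mono; [|apply (punctured_and _ _ _ H1 (Hall N))].
  intros z [Hz HNz]; symmetry; apply HNz; destruct (HJ z) as [HJ1 HJ2];
    assert (T := Re_ball z z0 1 ltac:(lra)).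
  + apply INR_le; eapply Rle_trans; [apply HJ2|].
    assert (T1 := Rle_abs (- Re z0)); rewrite Rabs_Ropp in T1.
    assert (T2 := Rabs_pos (Re z0)); apply Rmax_lub; lra.
  + lra.
- apply (proj2 (HF J0)); assert (T := proj1 (HJ z0)); fold J0 in T; lra.
Qed.

Lemma riemann_zeta_exists : exists f, is_riemann_zeta f.
Proof.
destruct zeta_minus_1_exists as [Z0 [HZ Hhol]].
destruct (zeta_minus_1_continuation Z0 HZ Hhol) as [F [HF1 HF2]].
destruct (meromorphic_normalization (fun s => 1 + F s)) as [f [Hf1 [_ Hf2]]].
- intros z0; apply weakly_meromorphic_plus; auto.
  apply holomorphic_weakly_meromorphic, holomorphic_const.
- exists f; split; auto; intros s Hs; rewrite Hf2.
  + rewrite HF1 by auto; rewrite <- (cpow_1_l (- s)) at 1.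
    apply (is_cseries_cons (fun k => cpow (INR (S k)) (- s))), HZ; auto.
  + apply holomorphic_plus; [apply holomorphic_const|].
    apply holomorphic_ext with Z0; auto.
    eapply near_mono; [|apply (near_Re_gt 1 s Hs)]; intros z Hz; symmetry; auto.
Qed.

Lemma riemann_zeta_spec : is_riemann_zeta riemann_zeta.
Proof. exact (epsilon_spec _ _ riemann_zeta_exists). Qed.

Lemma riemann_zeta_series (s : C) :
  (1 < Re s)%R -> is_cseries (fun k => cpow (INR (S k)) (- s)) (riemann_zeta s).
Proof. apply riemann_zeta_spec. Qed.

Lemma weakly_meromorphic_riemann_zeta (s : C) : weakly_meromorphic_at riemann_zeta s.
Proof. apply meromorphic_weakly, riemann_zeta_spec. Qed.

(** The specification gives the values for Re s > 1 but not holomorphy there; both come together by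
    comparison with the holomorphic sum [1 + Z0]. *)
Lemma holomorphic_riemann_zeta (s : C) :
  (1 < Re s)%R -> holomorphic_at riemann_zeta s.
Proof.
intros Hs; destruct zeta_minus_1_exists as [Z0 [HZ Hhol]].
apply holomorphic_ext with (fun s => 1 + Z0 s).
- eapply near_mono; [|apply (near_Re_gt 1 s Hs)]; intros z Hz.
  apply is_cseries_unique with (fun k => cpow (INR (S k)) (- z));
    [|apply riemann_zeta_series; auto].
  rewrite <- (cpow_1_l (- z)) at 1.
  apply (is_cseries_cons (fun k => cpow (INR (S k)) (- z))), HZ; auto.
- apply holomorphic_plus; auto; apply holomorphic_const.
Qed.

(** * Multiplicities and the zeta functions of spheres *)

Lemma is_cseries_csum (a : nat -> nat -> C) (b : nat -> C) (n : nat) :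
  (forall i, (i <= n)%nat -> is_cseries (a i) (b i)) ->
  is_cseries (fun k => csum (fun i => a i k) n) (csum b n).
Proof.
induction n as [|n IH]; intros H; simpl; [apply H; auto|].
apply is_cseries_plus; auto.
Qed.

Lemma holomorphic_csum (f : nat -> C -> C) (z0 : C) (n : nat) :
  (forall i, (i <= n)%nat -> holomorphic_at (f i) z0) ->
  holomorphic_at (fun z => csum (fun i => f i z) n) z0.
Proof.
induction n as [|n IH]; intros H; simpl; [apply H; auto|].
apply holomorphic_plus; auto.
Qed.

Lemma csum_last (u : nat -> C) (n : nat) :
  (forall j, (j < n)%nat -> u j = 0) -> csum u n = u n.
Proof.
destruct n as [|n]; intros H; [reflexivity|]; simpl.
replace (csum u n) with (RtoC 0); [ring|].
induction n as [|n IH]; simpl; [rewrite H; auto|].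
rewrite <- IH, H by (auto; intros; apply H; lia); ring.
Qed.

Lemma sum_n_m_1_csum (f : nat -> C) (m : nat) :
  @sum_n_m C_AbelianMonoid f 1 (S m) = csum (fun i => f (S i)) m.
Proof. rewrite <- csum_sum_n; unfold sum_n; rewrite sum_n_m_S; reflexivity. Qed.

Lemma RtoC_sum_n_m_1 (f : nat -> R) (m : nat) :
  RtoC (sum_n_m f 1 (S m)) = csum (fun i => RtoC (f (S i))) m.
Proof.
rewrite <- sum_n_m_S; change (sum_n_m (fun i => f (S i)) 0 m) with (sum_n (fun i => f (S i)) m).
rewrite sum_n_Reals; induction m as [|m IH]; simpl; auto.
rewrite RtoC_plus, IH; auto.
Qed.

(** * Multiplicities as polynomials in the shifted variable *)

Lemma Rprod_snoc (l : list R) (x : R) : Rprod (l ++ x :: nil) = (Rprod l * x)%R.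
Proof. induction l as [|y l IH]; simpl; [|rewrite IH]; ring. Qed.

Lemma Rprod_0 (l : list R) : In 0%R l -> Rprod l = 0%R.
Proof.
induction l as [|y l IH]; simpl; intros []; [subst; ring|rewrite IH by auto; ring].
Qed.

Definition u_prod (n : nat) (x : R) : R :=
  Rprod (map (fun i => x ^ 2 - INR i ^ 2)%R (seq 0 n)).

(** The factor [x ^ 2] from the root 0 is left out: the multiplicity is a constant times
    [x v_prod n x], an odd polynomial in [x], twice the shifted variable. *)
Definition v_prod (n : nat) (x : R) : R :=
  Rprod (map (fun i => x ^ 2 - (2 * INR i - 1) ^ 2)%R (seq 1 (n - 1))).

Lemma u_prod_S (n : nat) (x : R) :
  u_prod (S n) x = (u_prod n x * (x ^ 2 - INR n ^ 2))%R.
Proof. unfold u_prod; rewrite seq_S, map_app; apply Rprod_snoc. Qed.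

Lemma v_prod_SS (n : nat) (x : R) :
  v_prod (S (S n)) x = (v_prod (S n) x * (x ^ 2 - (2 * INR (S n) - 1) ^ 2))%R.
Proof.
unfold v_prod; simpl Nat.sub; rewrite Nat.sub_0_r, seq_S, map_app; apply Rprod_snoc.
Qed.

Lemma INR_fact_S (n : nat) : INR (fact (S n)) = (INR (S n) * INR (fact n))%R.
Proof. rewrite fact_simpl; apply mult_INR. Qed.

(** The factors split as [(x - i) (x + i)]; at [x = n + 1 + k] they give [x] times a product of
    consecutive integers. In the induction [n] and [k] move oppositely, so that [x] stays fixed. *)
Lemma u_prod_fact (n k : nat) :
  (u_prod (S n) (INR (S n + k)) * INR (fact k) =
   INR (S n + k) * INR (fact (2 * n + 1 + k)))%R.
Proof.
revert k; induction n as [|n IH]; intros k.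
- change (2 * 0 + 1 + k)%nat with (S k); rewrite INR_fact_S.
  change (1 + k)%nat with (S k); unfold u_prod; cbn -[INR]; rewrite INR_0; ring.
- rewrite u_prod_S; specialize (IH (S k)).
  replace (S n + S k)%nat with (S (S n) + k)%nat in IH by lia.
  replace (2 * n + 1 + S k)%nat with (2 * n + 2 + k)%nat in IH by lia.
  replace (2 * S n + 1 + k)%nat with (S (2 * n + 2 + k)) by lia.
  rewrite INR_fact_S in IH |- *; set (x := INR (S (S n) + k)) in *.
  replace (x ^ 2 - INR (S n) ^ 2)%R with (INR (S k) * INR (S (2 * n + 2 + k)))%R.
  + transitivity (u_prod (S n) x * (INR (S k) * INR (fact k)) *
      INR (S (2 * n + 2 + k)))%R; [ring|rewrite IH; ring].
  + unfold x; rewrite !S_INR, !plus_INR, mult_INR, !S_INR; simpl; ring.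
Qed.

(** Here [x ^ 2 - (2 i - 1) ^ 2 = 4 (n + k + 1 - i) (n + k + i)], and the two runs join to
    [k + 1, ..., 2 n + k]. *)
Lemma v_prod_fact (n k : nat) :
  (v_prod (S n) (2 * INR (n + k) + 1) * INR (fact k) =
   4 ^ n * INR (fact (2 * n + k)))%R.
Proof.
revert k; induction n as [|n IH]; intros k.
- unfold v_prod; simpl; ring.
- rewrite v_prod_SS; specialize (IH (S k)).
  replace (n + S k)%nat with (S n + k)%nat in IH by lia.
  replace (2 * n + S k)%nat with (2 * n + 1 + k)%nat in IH by lia.
  replace (2 * S n + k)%nat with (S (2 * n + 1 + k)) by lia.
  rewrite INR_fact_S in IH |- *; set (x := (2 * INR (S n + k) + 1)%R) in *.
  replace (x ^ 2 - (2 * INR (S n) - 1) ^ 2)%R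
    with (4 * INR (S k) * INR (S (2 * n + 1 + k)))%R.
  + transitivity (v_prod (S n) x * (INR (S k) * INR (fact k)) *
      (4 * INR (S (2 * n + 1 + k))))%R; [ring|rewrite IH; simpl pow; ring].
  + unfold x; rewrite !S_INR, !plus_INR, mult_INR, !S_INR; simpl; ring.
Qed.

(** These zeros let the Dirichlet series run over all positive integers although the sphere series
    starts later. *)
Lemma u_prod_0 (n m : nat) : (m < n)%nat -> u_prod n (INR m) = 0%R.
Proof.
intros H; apply Rprod_0; replace 0%R with (INR m ^ 2 - INR m ^ 2)%R by ring.
apply (in_map (fun i => INR m ^ 2 - INR i ^ 2)%R), in_seq; lia.
Qed.

Lemma v_prod_0 (n m : nat) : (S m < n)%nat -> v_prod n (2 * INR m + 1) = 0%R.
Proof.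
intros H; apply Rprod_0.
replace 0%R with ((2 * INR m + 1) ^ 2 - (2 * INR (S m) - 1) ^ 2)%R
  by (rewrite S_INR; ring).
apply (in_map (fun i => (2 * INR m + 1) ^ 2 - (2 * INR i - 1) ^ 2)%R), in_seq; lia.
Qed.

Lemma csum_ubar (n : nat) (x : R) :
  csum (fun i => RtoC (ubar (S n) (S i)) * RtoC x ^ (2 * S i)) n =
  RtoC (2 / INR (fact (2 * S n)) * u_prod (S n) x).
Proof.
unfold u_prod; rewrite <- (cfn_u_spec (S n) (x ^ 2)) by lia.
rewrite RtoC_mult, RtoC_sum_n_m_1, <- csum_scal; apply csum_ext; intros i _.
unfold ubar; rewrite !RtoC_mult, !RtoC_pow, Cpow_mult_r; ring.
Qed.

Lemma csum_vbar (n : nat) (x : R) : x <> 0%R ->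
  csum (fun i => RtoC (vbar (S n) (S i)) * RtoC x ^ (2 * S i - 1)) n =
  RtoC (/ 4 ^ n / INR (fact (2 * n + 1)) * x * v_prod (S n) x).
Proof.
intros Hx.
(* The generating identity yields [x ^ 2 v_prod]; dividing by [x] lowers every exponent [2 i] to
   [2 i - 1]. *)
replace (/ 4 ^ n / INR (fact (2 * n + 1)) * x * v_prod (S n) x)%R with
  (/ 4 ^ n / INR (fact (2 * n + 1)) / x * (x ^ 2 * v_prod (S n) x))%R.
2: { assert (H1 := INR_fact_neq_0 (2 * n + 1)).
     assert (H2 := pow_nonzero 4 n ltac:(lra)); field; auto. }
unfold v_prod; rewrite <- (cfn_v_spec (S n) (x ^ 2)) by lia.
rewrite RtoC_mult, RtoC_sum_n_m_1, <- csum_scal; apply csum_ext; intros i _.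
unfold vbar; replace (S n - 1)%nat with n by lia.
replace (2 * S n - 1)%nat with (2 * n + 1)%nat by lia.
rewrite <- !RtoC_pow, <- !RtoC_mult; f_equal.
rewrite <- pow_mult; replace (2 * S i)%nat with (S (2 * S i - 1)) by lia.
replace (S (2 * S i - 1) - 1)%nat with (2 * S i - 1)%nat by lia.
simpl pow; field; repeat split; auto;
  solve [apply INR_fact_neq_0|apply pow_nonzero; lra].
Qed.

Lemma sphere_mult_odd (n k : nat) :
  sphere_mult (2 * S n + 1) k =
  (2 / INR (fact (2 * S n)) * u_prod (S n) (INR (S n + k)))%R.
Proof.
unfold sphere_mult.
replace (2 * S n + 1 - 1)%nat with (2 * S n)%nat by lia.
replace (k + (2 * S n + 1) - 2)%nat with (2 * n + 1 + k)%nat by lia.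
replace (2 * k + (2 * S n + 1) - 1)%nat with (2 * (S n + k))%nat by lia.
assert (H := u_prod_fact n k); rewrite (mult_INR 2); change (INR 2) with 2%R.
assert (H1 := INR_fact_neq_0 k); assert (H2 := INR_fact_neq_0 (2 * S n)).
replace (u_prod (S n) (INR (S n + k))) with
  (u_prod (S n) (INR (S n + k)) * INR (fact k) / INR (fact k))%R by (field; auto).
rewrite H; field; auto.
Qed.

Lemma sphere_mult_even (n k : nat) :
  sphere_mult (2 * S n) k =
  (/ 4 ^ n / INR (fact (2 * n + 1)) * (2 * INR (n + k) + 1) *
    v_prod (S n) (2 * INR (n + k) + 1))%R.
Proof.
unfold sphere_mult.
replace (2 * S n - 1)%nat with (2 * n + 1)%nat by lia.
replace (k + 2 * S n - 2)%nat with (2 * n + k)%nat by lia.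
replace (2 * k + 2 * S n - 1)%nat with (2 * (n + k) + 1)%nat by lia.
assert (H := v_prod_fact n k); rewrite plus_INR, (mult_INR 2).
change (INR 2) with 2%R; change (INR 1) with 1%R.
assert (H1 := INR_fact_neq_0 k); assert (H2 := INR_fact_neq_0 (2 * n + 1)).
assert (H3 := pow_nonzero 4 n ltac:(lra)).
replace (v_prod (S n) (2 * INR (n + k) + 1)) with
  (v_prod (S n) (2 * INR (n + k) + 1) * INR (fact k) / INR (fact k))%R by (field; auto).
rewrite H; field; auto.
Qed.

(** The eigenvalue 0 is excluded from the series; its term is the single power subtracted in each
    identity. *)
Lemma sphere_mult_0 (n : nat) : (2 <= n)%nat -> sphere_mult n 0 = 1%R.
Proof.
intros Hn; destruct n as [|[|n]]; try lia; unfold sphere_mult.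
replace (0 + S (S n) - 2)%nat with n by lia.
replace (2 * 0 + S (S n) - 1)%nat with (S n) by lia.
replace (S (S n) - 1)%nat with (S n) by lia.
rewrite INR_fact_S; change (INR (fact 0)) with 1%R.
field; split; [apply INR_fact_neq_0|apply not_0_INR; lia].
Qed.

Lemma csum_even_odd (a : nat -> C) (n : nat) :
  csum a (2 * n + 1) =
  csum (fun k => a (2 * k)%nat) n + csum (fun k => a (2 * k + 1)%nat) n.
Proof.
induction n as [|n IH]; [reflexivity|].
replace (2 * S n + 1)%nat with (S (S (2 * n + 1))) by lia.
change (csum a (S (S (2 * n + 1)))) with
  (csum a (2 * n + 1) + a (S (2 * n + 1)) + a (S (S (2 * n + 1)))).
rewrite IH; cbn [csum].
replace (2 * S n)%nat with (S (2 * n + 1)) by lia.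
replace (S (2 * n + 1) + 1)%nat with (S (S (2 * n + 1))) by lia; ring.
Qed.

(** Cut the full series after [2 n + 2] terms: each parity then contributes [n + 1]. *)
Lemma is_cseries_even_terms (a : nat -> C) (l m : C) :
  is_cseries a l -> is_cseries (fun k => a (2 * k + 1)%nat) m ->
  is_cseries (fun k => a (2 * k)%nat) (l - m).
Proof.
rewrite !is_cseries_eps; intros H1 H2 eps He.
destruct (H1 (eps / 2)%R ltac:(lra)) as [N1 HN1].
destruct (H2 (eps / 2)%R ltac:(lra)) as [N2 HN2].
exists (max N1 N2); intros n Hn.
specialize (HN1 (2 * n + 1)%nat ltac:(lia)); specialize (HN2 n ltac:(lia)).
rewrite csum_even_odd in HN1.
set (x := csum (fun k => a (2 * k)%nat) n) in *.
set (y := csum (fun k => a (2 * k + 1)%nat) n) in *.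
replace (x - (l - m)) with ((x + y - l) + - (y - m)) by ring.
eapply Rle_lt_trans; [apply Cmod_triangle|]; rewrite Cmod_opp; lra.
Qed.

Lemma is_cseries_odd_zeta (w : C) :
  (1 < Re w)%R ->
  is_cseries (fun k => cpow (2 * INR k + 1) (- w)) ((1 - cpow 2 (- w)) * riemann_zeta w).
Proof.
intros Hw; assert (H := riemann_zeta_series w Hw).
replace ((1 - cpow 2 (- w)) * riemann_zeta w)
  with (riemann_zeta w - cpow 2 (- w) * riemann_zeta w) by ring.
(* Index [k] stands for the integer [k + 1], so the even indices are the odd integers. *)
eapply is_cseries_ext; [|apply (is_cseries_even_terms _ _ _ H)].
- intros k; cbv beta; f_equal; rewrite S_INR, mult_INR; simpl; ring.
- eapply is_cseries_ext, is_cseries_scal, H; intros k; cbv beta.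
  rewrite <- cpow_mult_l; [|lra|apply lt_0_INR; lia].
  f_equal; replace (S (2 * k + 1)) with (2 * S k)%nat by lia.
  rewrite (mult_INR 2); reflexivity.
Qed.

(** The candidate [G] serves twice: normalized, it shows that [epsilon] has something to choose;
    then the identity theorem compares it with the choice, whose abscissa [b] may differ from
    [a]. *)
Lemma shifted_sphere_zeta_unique (N : nat) (G : C -> C) (a : R) :
  (forall s, weakly_meromorphic_at G s) ->
  (forall s, (a < Re s)%R -> holomorphic_at G s /\
     is_cseries (fun k => sphere_term N (S k) s) (G s)) ->
  meromorphic_eq (shifted_sphere_zeta N) G.
Proof.
intros HG Ha.
assert (Hex : exists F, is_shifted_sphere_zeta N F).
{ destruct (meromorphic_normalization G HG) as [F [HF1 [_ HF2]]].
  exists F; split; auto; exists a; intros s Hs; rewrite HF2; apply Ha; auto. }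
destruct (epsilon_spec (inhabits (fun _ : C => RtoC 0)) _ Hex) as [Hm [b Hb]].
fold (shifted_sphere_zeta N) in Hm, Hb.
intros z0; apply (half_plane_identity _ _ (Re z0 - 1) (Rmax a b)); auto.
- intros s _; apply meromorphic_weakly; auto.
- intros s Hs; eapply is_cseries_unique; [apply Hb|apply Ha].
  + eapply Rle_lt_trans; [apply Rmax_r|apply Hs].
  + eapply Rle_lt_trans; [apply Rmax_l|apply Hs].
- lra.
Qed.

(** * The two identities, for odd and for even dimension *)

Lemma RtoC_2_neq_0 : RtoC 2 <> 0.
Proof. intros H; apply RtoC_inj in H; lra. Qed.

Lemma weakly_meromorphic_zeta_2 (be s : C) :
  weakly_meromorphic_at (fun s => riemann_zeta (2 * s + be)) s.
Proof.
apply weakly_meromorphic_affine; [apply RtoC_2_neq_0|].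
apply weakly_meromorphic_riemann_zeta.
Qed.

Lemma holomorphic_zeta_2 (be s : C) : (1 < Re (2 * s + be))%R ->
  holomorphic_at (fun s => riemann_zeta (2 * s + be)) s.
Proof.
intros H; apply holomorphic_affine; [apply RtoC_2_neq_0|].
apply holomorphic_riemann_zeta; auto.
Qed.

Lemma holomorphic_cpow_2 (x : R) (s : C) :
  holomorphic_at (fun s => - (1) * cpow x (- (2 * s))) s.
Proof.
apply holomorphic_mult; [apply holomorphic_const|].
apply holomorphic_ext with (fun s => cpow x (- (2) * s + 0)).
- exists 1%R; split; [lra|]; intros; f_equal; ring.
- apply holomorphic_affine, holomorphic_cpow.
  intros E; apply RtoC_2_neq_0; replace (RtoC 2) with (- - RtoC 2) by ring.
  rewrite E; ring.
Qed.

Lemma cpow_even_shift (x : R) (s : C) (i : nat) : (0 < x)%R ->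
  cpow x (- (2 * s + - (2) * RtoC (INR i))) = RtoC x ^ (2 * i) * cpow x (- (2 * s)).
Proof.
intros Hx; rewrite <- cpow_INR, <- cpow_plus by auto; f_equal.
rewrite mult_INR, RtoC_mult; change (INR 2) with 2%R; ring.
Qed.

Lemma cpow_odd_shift (x : R) (s : C) (i : nat) : (0 < x)%R ->
  cpow x (- (2 * s + (1 - 2 * RtoC (INR (S i))))) =
  RtoC x ^ (2 * S i - 1) * cpow x (- (2 * s)).
Proof.
intros Hx; rewrite <- cpow_INR, <- cpow_plus by auto; f_equal.
rewrite minus_INR, mult_INR, RtoC_minus, RtoC_mult by lia.
change (INR 2) with 2%R; change (INR 1) with 1%R; ring.
Qed.

Lemma cpow_4 (s : C) : cpow 4 s * cpow 2 (- (2 * s)) = 1.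
Proof.
replace 4%R with (2 * 2)%R by ring; rewrite cpow_mult_l, <- !cpow_plus by lra.
rewrite <- (cpow_0 2); f_equal; ring.
Qed.

(** The subtraction and the arguments of zeta are written in the shapes [f + g] and [2 * s + be] of
    the closure lemmas. For [Re s > n + 2] every argument of zeta has real part above 1. *)
Lemma shifted_sphere_zeta_odd (n : nat) :
  meromorphic_eq (shifted_sphere_zeta (2 * S n + 1))
    (fun s => csum (fun i => RtoC (ubar (S n) (S i)) *
        riemann_zeta (2 * s + - (2) * RtoC (INR (S i)))) n
      + - (1) * cpow (INR (S n)) (- (2 * s))).
Proof.
apply shifted_sphere_zeta_unique with (INR n + 2)%R.
- intros s; apply weakly_meromorphic_plus.
  + apply (weakly_meromorphic_csum (fun i s => RtoC (ubar (S n) (S i)) *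
      riemann_zeta (2 * s + - (2) * RtoC (INR (S i))))).
    intros i _; apply weakly_meromorphic_mult; [|apply weakly_meromorphic_zeta_2].
    apply holomorphic_weakly_meromorphic, holomorphic_const.
  + apply holomorphic_weakly_meromorphic, holomorphic_cpow_2.
- intros s Hs.
  assert (HRe : forall i, (i <= n)%nat ->
    (1 < Re (2 * s + - (2) * RtoC (INR (S i))))%R).
  { intros i Hi; change (Re (2 * s + - (2) * RtoC (INR (S i))))
      with (Re (RtoC 2 * s) + Re (- RtoC 2 * RtoC (INR (S i))))%R.
    rewrite re_scal_l, re_scal_r; change (Re (- RtoC 2)) with (- (2))%R.
    apply le_INR in Hi; rewrite S_INR; lra. }
  split.
  + apply holomorphic_plus; [|apply holomorphic_cpow_2].
    apply (holomorphic_csum (fun i s => RtoC (ubar (S n) (S i)) *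
      riemann_zeta (2 * s + - (2) * RtoC (INR (S i))))).
    intros i Hi; apply holomorphic_mult; [apply holomorphic_const|].
    apply holomorphic_zeta_2; auto.
  + set (u := fun k => RtoC (2 / INR (fact (2 * S n)) * u_prod (S n) (INR (S k))) *
      cpow (INR (S k)) (- (2 * s))).
    set (l := csum _ n).
    (* Exchanging the finite sum over [i] with the Dirichlet series produces the multiplicity
       polynomial at every positive integer [k + 1]. *)
    assert (Hu : is_cseries u l).
    { eapply is_cseries_ext, is_cseries_csum.
      2: { intros i Hi; apply is_cseries_scal, riemann_zeta_series, HRe; auto. }
      intros k; cbv beta; unfold u; rewrite <- csum_ubar, (Cmult_comm (csum _ _)), <- csum_scal.
      apply csum_ext; intros i _; rewrite cpow_even_shift by (apply lt_0_INR; lia); ring. }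
    (* The first [n] terms vanish; term [n], at the integer [n + 1], belongs to the eigenvalue 0.
       Dropping all of them leaves the sphere series. *)
    assert (H1 : csum u n = cpow (INR (S n)) (- (2 * s))).
    { rewrite csum_last.
      - unfold u; assert (E := sphere_mult_odd n 0).
        rewrite Nat.add_0_r in E; rewrite <- E, sphere_mult_0 by lia; ring.
      - intros j Hj; unfold u; rewrite u_prod_0, Rmult_0_r by lia; ring. }
    replace (l + - (1) * cpow (INR (S n)) (- (2 * s))) with (l - csum u n)
      by (rewrite H1; ring).
    eapply is_cseries_ext, is_cseries_drop, Hu.
    intros k; unfold u, sphere_term; rewrite sphere_mult_odd.
    replace (S n + S k)%nat with (S (S n + k)) by lia; do 2 f_equal.
    rewrite S_INR, plus_INR, (S_INR k), (plus_INR (2 * S n)), (mult_INR 2).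
    simpl INR; field.
Qed.

Lemma shifted_sphere_zeta_even (n : nat) :
  meromorphic_eq (shifted_sphere_zeta (2 * S n))
    (fun s => csum (fun i => (RtoC (vbar (S n) (S i)) *
          (cpow 4 s + - RtoC 2 ^ (2 * S i - 1))) *
        riemann_zeta (2 * s + (1 - 2 * RtoC (INR (S i))))) n
      + - (1) * cpow ((2 * INR (S n) - 1) / 2) (- (2 * s))).
Proof.
apply shifted_sphere_zeta_unique with (INR n + 2)%R.
- intros s; apply weakly_meromorphic_plus.
  + apply (weakly_meromorphic_csum (fun i s => (RtoC (vbar (S n) (S i)) *
          (cpow 4 s + - RtoC 2 ^ (2 * S i - 1))) *
        riemann_zeta (2 * s + (1 - 2 * RtoC (INR (S i)))))).
    intros i _; apply weakly_meromorphic_mult; [|apply weakly_meromorphic_zeta_2].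
    apply holomorphic_weakly_meromorphic, holomorphic_mult; [apply holomorphic_const|].
    apply holomorphic_plus; [apply holomorphic_cpow|apply holomorphic_const].
  + apply holomorphic_weakly_meromorphic, holomorphic_cpow_2.
- intros s Hs.
  assert (HRe : forall i, (i <= n)%nat ->
    (1 < Re (2 * s + (1 - 2 * RtoC (INR (S i)))))%R).
  { intros i Hi; change (Re (2 * s + (1 - 2 * RtoC (INR (S i)))))
      with (Re (RtoC 2 * s) + (1 + - Re (RtoC 2 * RtoC (INR (S i)))))%R.
    rewrite !re_scal_l, re_RtoC; apply le_INR in Hi; rewrite S_INR; lra. }
  split.
  + apply holomorphic_plus; [|apply holomorphic_cpow_2].
    apply (holomorphic_csum (fun i s => (RtoC (vbar (S n) (S i)) *
          (cpow 4 s + - RtoC 2 ^ (2 * S i - 1))) *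
        riemann_zeta (2 * s + (1 - 2 * RtoC (INR (S i)))))).
    intros i Hi; apply holomorphic_mult; [|apply holomorphic_zeta_2; auto].
    apply holomorphic_mult; [apply holomorphic_const|].
    apply holomorphic_plus; [apply holomorphic_cpow|apply holomorphic_const].
  (* The shifted variable runs through the half-integers [q k / 2]; the polynomial is evaluated at
     the odd integers [q k]. *)
  + set (q := fun k => (2 * INR k + 1)%R).
    assert (Hq : forall k, (0 < q k)%R)
      by (intros k; unfold q; assert (T := pos_INR k); lra).
    set (u := fun k => RtoC (/ 4 ^ n / INR (fact (2 * n + 1)) * q k * v_prod (S n) (q k)) *
      cpow (q k / 2) (- (2 * s))).
    set (l := csum _ n).
    assert (Hu : is_cseries u l).
    { unfold l; erewrite csum_ext.
      2: { intros i _.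
           (* The Euler factor at 2 appears: [1 - 2 ^ (- w)] with [w] the argument of zeta restricts
              the series to odd integers, and [4 ^ s] turns [q ^ (- 2 s)] into
              [(q / 2) ^ (- 2 s)]. *)
           replace (cpow 4 s + - RtoC 2 ^ (2 * S i - 1)) with (cpow 4 s *
             (1 - cpow 2 (- (2 * s + (1 - 2 * RtoC (INR (S i))))))).
           - rewrite Cmult_assoc, <- Cmult_assoc; reflexivity.
           - rewrite cpow_odd_shift by lra.
             transitivity (cpow 4 s - RtoC 2 ^ (2 * S i - 1) *
               (cpow 4 s * cpow 2 (- (2 * s)))); [ring|rewrite cpow_4; ring]. }
      eapply is_cseries_ext, is_cseries_csum.
      2: { intros i Hi; apply is_cseries_scal, is_cseries_odd_zeta, HRe; auto. }
      intros k; cbv beta; fold (q k); unfold u.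
      rewrite <- csum_vbar by (specialize (Hq k); lra); rewrite (Cmult_comm (csum _ _)), <- csum_scal.
      apply csum_ext; intros i _; rewrite cpow_odd_shift by auto.
      replace (cpow (q k) (- (2 * s))) with
        (cpow (q k / 2) (- (2 * s)) * cpow 2 (- (2 * s))).
      - set (p := cpow (q k / 2) (- (2 * s))).
        transitivity (RtoC (vbar (S n) (S i)) * RtoC (q k) ^ (2 * S i - 1) * p *
          (cpow 4 s * cpow 2 (- (2 * s)))); [ring|rewrite cpow_4; ring].
      - specialize (Hq k); rewrite <- cpow_mult_l by lra; f_equal; field. }
    (* Again only term [n] survives, now at the half-integer [(2 n + 1) / 2], where the multiplicity
       is that of [k = 0]. *)
    assert (H1 : csum u n = cpow ((2 * INR (S n) - 1) / 2) (- (2 * s))).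
    { rewrite csum_last.
      - unfold u; assert (E := sphere_mult_even n 0).
        rewrite Nat.add_0_r in E; fold (q n) in E.
        rewrite <- E, sphere_mult_0 by lia; rewrite Cmult_1_l.
        f_equal; unfold q; rewrite S_INR; field.
      - intros j Hj; unfold u, q; rewrite v_prod_0, Rmult_0_r by lia; ring. }
    replace (l + - (1) * cpow ((2 * INR (S n) - 1) / 2) (- (2 * s))) with (l - csum u n)
      by (rewrite H1; ring).
    eapply is_cseries_ext, is_cseries_drop, Hu.
    intros k; unfold u, sphere_term; rewrite sphere_mult_even; unfold q.
    replace (n + S k)%nat with (S n + k)%nat by lia; do 2 f_equal.
    rewrite (mult_INR 2), plus_INR, !S_INR; simpl INR; field.
Qed.

Lemma meromorphic_eq_ext (f g h : C -> C) :
  (forall s, g s = h s) -> meromorphic_eq f g -> meromorphic_eq f h.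
Proof.
intros E H z0; eapply punctured_mono; [|apply (H z0)].
intros z Hz; rewrite <- E; exact Hz.
Qed.

Theorem theorem2p4 (n : nat) (hn : (1 <= n)%nat) :
  meromorphic_eq (shifted_sphere_zeta (2 * n + 1))
    (fun s : C =>
       @sum_n_m C_AbelianMonoid
         (fun i : nat => ubar n i * riemann_zeta (2 * (s - INR i))) 1 n
       - cpow (INR n) (- (2 * s)))
  /\
  meromorphic_eq (shifted_sphere_zeta (2 * n))
    (fun s : C =>
       @sum_n_m C_AbelianMonoid
         (fun i : nat =>
            vbar n i * (cpow 4 s - 2 ^ (2 * i - 1))
            * riemann_zeta (2 * s - 2 * INR i + 1)) 1 n
       - cpow ((2 * INR n - 1) / 2) (- (2 * s))).
Proof.
destruct n as [|m]; [lia|]; split.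
- eapply meromorphic_eq_ext; [|apply shifted_sphere_zeta_odd].
  intros s; rewrite sum_n_m_1_csum.
  rewrite (csum_ext _ (fun i => RtoC (ubar (S m) (S i)) *
    riemann_zeta (2 * (s - RtoC (INR (S i)))))); [ring|].
  intros i _; do 2 f_equal; ring.
- eapply meromorphic_eq_ext; [|apply shifted_sphere_zeta_even].
  intros s; rewrite sum_n_m_1_csum.
  rewrite (csum_ext _ (fun i => vbar (S m) (S i) * (cpow 4 s - 2 ^ (2 * S i - 1)) *
    riemann_zeta (2 * s - 2 * INR (S i) + 1))); [ring|].
  intros i _; do 2 f_equal; ring.
Qed.
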